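(* Let $\mathfrak{g}_{2|4}^{2}$ and $\mathfrak{g}_{2|4}^{3}(\lambda)$ ($\lambda\in\mathbb{C}$) be the complex Lie superalgebras of dimension $2|4$ with basis $\{e_1,e_2\mid e_3,e_4,e_5,e_6\}$ ($e_1,e_2$ even, $e_3,\dots,e_6$ odd) and nontrivial brackets \begin{align*} \mathfrak{g}_{2|4}^{2}:\ &[e_2,e_4]=e_4,\ [e_2,e_5]=e_3,\ [e_2,e_6]=-e_6,\ [e_5,e_5]=[e_4,e_6]=e_1;\\ \mathfrak{g}_{2|4}^{3}(\lambda):\ &[e_2,e_3]=e_3,\ [e_2,e_4]=\lambda e_4,\ [e_2,e_5]=-e_5,\ [e_2,e_6]=-\lambda e_6,\ [e_3,e_5]=e_1,\ [e_4,e_6]=\lambda e_1. \end{align*} Then $\mathfrak{g}_{2|4}^{2}$ has only one (nontrivial) metric deformation, up to equivalence and change of parameter, and it is a smooth metric deformation to the family $\mathfrak{g}_{2|4}^{3}(\lambda)$ around $\lambda=0$.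
   Context: All Lie superalgebras are over $\mathbb{C}$. Brackets of basis elements that are not listed are zero or determined by $[y,x]=-(-1)^{|x||y|}[x,y]$. A metric Lie superalgebra is a Lie superalgebra together with an even, non-degenerate, supersymmetric bilinear form $B$ that is invariant: $B([x,y],z)=B(x,[y,z])$. A formal 1-parameter deformation of a Lie superalgebra $(\mathfrak g,[\ ,\ ])$ is a $\mathbb{C}[[t]]$-bilinear Lie superalgebra structure on $\mathfrak g[[t]]=\mathfrak g\otimes_{\mathbb C}\mathbb{C}[[t]]$ of the form $[\ ,\ ]_t=[\ ,\ ]+\sum_{i\ge1}t^i\phi_i$, each $\phi_i:\mathfrak g\times\mathfrak g\to\mathfrak g$ being an even super-skew-symmetric bilinear map. Two such deformations $[\ ,\ ]_t,[\ ,\ ]'_t$ are equivalent if there is $\widehat\psi_t=\mathrm{id}+\psi_1t+\psi_2t^2+\cdots$ with even linear $\psi_i:\mathfrak g\to\mathfrak g$ and $\widehat\psi_t([x,y]_t)=[\widehat\psi_t(x),\widehat\psi_t(y)]'_t$ for all $x,y\in\mathfrak g$. A deformation is trivial if it is equivalent to the original bracket. A metric deformation is a formal 1-parameter deformation that defines a metric Lie superalgebra, i.e. $(\mathfrak g[[t]],[\ ,\ ]_t)$ admits an even, supersymmetric, invariant $\mathbb{C}[[t]]$-bilinear form that is non-degenerate over $\mathbb{C}[[t]]$ (induces an isomorphism with the dual module). A deformation is smooth if for different non-zero values of $t$ near the origin it defines non-isomorphic algebras (coincidences caused by symmetry being allowed). It is a smooth deformation to a family $\mathfrak h(\lambda)$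 around $\lambda_0$ if it is smooth and for non-zero $t$ near the origin it is isomorphic to $\mathfrak h(\lambda(t))$ with $\lambda(t)\to\lambda_0$ as $t\to0$. *)

(* Defs.v *)
From HB Require Import structures.
From mathcomp Require Import all_boot all_order all_algebra.
From mathcomp Require Import complex.
From mathcomp Require Import all_classical all_reals all_analysis.

Set Implicit Arguments.
Unset Strict Implicit.
Unset Printing Implicit Defensive.

Import Order.TTheory GRing.Theory Num.Theory.
Import numFieldNormedType.Exports.

Local Open Scope classical_set_scope.
Local Open Scope ring_scope.

(* The ring K[[t]]; f n is the coefficient of t ^ n. *)
Definition fps (K : Type) : Type := nat -> K.

Section FormalPowerSeries.
Variable K : comNzRingType.

HB.instance Definition _ := GRing.Zmodule.copy (fps K) (nat -> K).

Definition fpsC (c : K) : fps K := fun n => if n is 0%N then c else 0.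

Definition fps_mul (f g : fps K) : fps K :=
  fun n => \sum_(i < n.+1) f i * g (n - i)%N.

Let trunc N (f : fps K) : {poly K} := \poly_(i < N) f i.

Let coef_trunc N f n : (n < N)%N -> (trunc N f)`_n = f n.
Proof. by move=> ltnN; rewrite coef_poly ltnN. Qed.

Let coef_fps_mul N (f g : fps K) n : (n < N)%N ->
  fps_mul f g n = (trunc N f * trunc N g)`_n.
Proof.
move=> ltnN; rewrite coefM; apply: eq_bigr => i _.
have lei : (i <= n)%N by rewrite -ltnS.
rewrite !coef_trunc //; first exact: leq_ltn_trans (leq_subr _ _) ltnN.
exact: leq_ltn_trans lei ltnN.
Qed.

Let fps_mulA : associative fps_mul.
Proof.
move=> f g h; apply/funext => n.
transitivity ((trunc n.+1 f * (trunc n.+1 g * trunc n.+1 h))`_n).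
  rewrite coefM; apply: eq_bigr => i _.
  by rewrite coef_trunc // (@coef_fps_mul n.+1) // ltnS leq_subr.
rewrite mulrA coefM; apply: eq_bigr => i _.
by rewrite coef_trunc ?ltnS ?leq_subr // -coef_fps_mul.
Qed.

Let fps_mulC : commutative fps_mul.
Proof.
by move=> f g; apply/funext => n; rewrite !(@coef_fps_mul n.+1) // mulrC.
Qed.

Let fps_mul1 : left_id (fpsC 1) fps_mul.
Proof.
move=> f; apply/funext => n; rewrite /fps_mul big_ord_recl /= mul1r subn0.
by rewrite big1 ?addr0 // => i _; rewrite /fpsC /= mul0r.
Qed.

Let fps_mulDl : left_distributive fps_mul +%R.
Proof.
move=> f g h; apply/funext => n.
have -> : (fps_mul f h + fps_mul g h) n = fps_mul f h n + fps_mul g h n by [].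
by rewrite /fps_mul -big_split /=; apply: eq_bigr => i _; rewrite -mulrDl.
Qed.

Let fps_1neq0 : fpsC 1 != 0 :> fps K.
Proof.
apply/eqP => /(congr1 (fun f : fps K => f 0%N)) /= h.
by move: (oner_neq0 K); rewrite -[1 in X in X -> _]/(fpsC 1 0%N) h eqxx.
Qed.

HB.instance Definition _ := GRing.Zmodule_isComNzRing.Build (fps K)
  fps_mulA fps_mulC fps_mul1 fps_mulDl fps_1neq0.

End FormalPowerSeries.

(* A free K-supermodule of rank m|n is realised as 'rV[K]_(m + n): the first m
   vectors of the canonical basis are even and the last n are odd. *)
Section LieSuperalgebras.
Variables (K : comNzRingType) (m n : nat).
Local Notation V := 'rV[K]_(m + n).
Implicit Types (br : V -> V -> V) (B : V -> V -> K) (p q : bool) (x y z : V).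

Definition parity (i : 'I_(m + n)) : bool := (m <= i)%N.

Definition homog p x : Prop := forall i, parity i != p -> x 0 i = 0.

Definition even_lin (f : V -> V) : Prop :=
  linear f /\ (forall p x, homog p x -> homog p (f x)).

Definition even_bilin br : Prop :=
  [/\ forall x, linear (br x), forall y, linear (br^~ y) &
      forall p q x y, homog p x -> homog q y -> homog (p (+) q) (br x y)].

Definition super_skew br : Prop :=
  forall p q x y, homog p x -> homog q y ->
    br y x = - ((-1) ^+ (p && q) *: br x y).

Definition super_jacobi br : Prop :=
  forall p q x y z, homog p x -> homog q y ->
    br x (br y z) = br (br x y) z + (-1) ^+ (p && q) *: br y (br x z).

Definition lie_superalgebra br : Prop :=
  [/\ even_bilin br, super_skew br & super_jacobi br].

(* nondegenerate: x |-> B x _ is a bijection of V with its dual module *)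
Definition metric_form br B : Prop :=
  [/\ (forall x, scalar (B x)) /\ (forall y, scalar (B^~ y)),
      forall p q x y, homog p x -> homog q y -> p != q -> B x y = 0,
      forall p q x y, homog p x -> homog q y ->
        B y x = (-1) ^+ (p && q) * B x y,
      forall x y z, B (br x y) z = B x (br y z) &
      forall L : {scalar V}, exists! x, forall y, B x y = L y].

Definition metric_lie_superalgebra br : Prop :=
  lie_superalgebra br /\ exists B, metric_form br B.

Definition isomorphic br br' : Prop :=
  exists f : V -> V,
    [/\ even_lin f, bijective f & forall x y, f (br x y) = br' (f x) (f y)].

(* The bilinear map whose value on the basis vectors number i <= j is c i j,
   the remaining values being given by super-skew-symmetry. *)
Definition bracket_of (c : 'I_(m + n) -> 'I_(m + n) -> V) : V -> V -> V :=
  fun x y => \sum_i \sum_j (x 0 i * y 0 j) *: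
    (if (i <= j)%N then c i j
     else - ((-1) ^+ (parity i && parity j) *: c j i)).

End LieSuperalgebras.

(* Formal 1-parameter deformations.  The module g[[t]], for g = K^{m|n}, is
   (K[[t]])^{m|n}, so that lie_superalgebra and metric_lie_superalgebra apply to
   it over the ring fps K.  A deformation is given by the sequence phi, with
   phi 0 the original bracket. *)
Section Deformations.
Variables (K : comNzRingType) (m n : nat).
Local Notation V := 'rV[K]_(m + n).
Local Notation Vt := 'rV[fps K]_(m + n).
Implicit Types (br : V -> V -> V) (phi : nat -> V -> V -> V).

Definition vcoef (k : nat) (x : Vt) : V := map_mx (fun f : fps K => f k) x.

Definition vseries (u : nat -> V) : Vt := \row_j ((fun k => u k 0 j) : fps K).

Definition vconst (x : V) : Vt := map_mx (@fpsC K) x.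

(* K[[t]]-bilinear extension of \sum_i t ^ i phi_i *)
Definition ext_bracket phi (x y : Vt) : Vt :=
  vseries (fun N => \sum_(i < N.+1) \sum_(j < (N - i).+1)
    phi i (vcoef j x) (vcoef (N - i - j) y)).

(* K[[t]]-linear extension of \sum_i t ^ i psi_i *)
Definition ext_lin (psi : nat -> V -> V) (x : Vt) : Vt :=
  vseries (fun N => \sum_(i < N.+1) psi i (vcoef (N - i) x)).

Definition deformation br phi : Prop :=
  [/\ phi 0%N = br, forall i, even_bilin (phi i) /\ super_skew (phi i) &
      lie_superalgebra (ext_bracket phi)].

Definition metric_deformation br phi : Prop :=
  deformation br phi /\ metric_lie_superalgebra (ext_bracket phi).

Definition equivalent phi phi' : Prop :=
  exists psi : nat -> V -> V,
    [/\ psi 0%N = id, forall i, even_lin (psi i) &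
        forall x y : V,
          ext_lin psi (ext_bracket phi (vconst x) (vconst y)) =
          ext_bracket phi' (ext_lin psi (vconst x)) (ext_lin psi (vconst y))].

Definition trivial_deformation br phi : Prop :=
  equivalent phi (fun i => if i is 0%N then br else fun _ _ => 0).

(* The substitution t := f(t), where f has no constant term: the coefficient of
   t ^ N in \sum_i f(t) ^ i phi_i only involves i <= N. *)
Definition reparam (f : fps K) phi : nat -> V -> V -> V :=
  fun N x y => \sum_(i < N.+1) ((f ^+ i : fps K) N) *: phi i x y.

End Deformations.

(* Convergent deformations over the complex numbers R[i], R : realType.  At a
   numerical t the deformation is the sum of its power series; the alias R[i]^o is the
   one carrying the topology. *)
Section SmoothDeformations.
Variables (R : realType) (m n : nat).
Local Notation C := R[i].
Local Notation V := 'rV[C]_(m + n).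
Implicit Types (phi : nat -> V -> V -> V) (nu : C -> V -> V -> V).

(* phi converges on the disc of radius r, to the bracket nu t at t *)
Definition sums_to phi (r : R) nu : Prop :=
  forall t : C, `|t| < r%:C%C -> forall (x y : V) (j : 'I_(m + n)),
    series (fun i => t ^+ i * phi i x y 0 j : C^o) @ \oo
      --> (nu t x y 0 j : C^o).

(* Distinct small nonzero t give non-isomorphic algebras, without exception; the
   coincidences that symmetry may cause are those h lambda ~ h lambda' of the
   target family below, about which nothing is required. *)
Definition smooth phi : Prop :=
  exists (r : R) nu, [/\ 0 < r, sums_to phi r nu &
    forall s t : C, 0 < `|s| < r%:C%C -> 0 < `|t| < r%:C%C -> s != t ->
      ~ isomorphic (nu s) (nu t)].

Definition smooth_to_family phi (h : C -> V -> V -> V) (lambda0 : C) : Prop :=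
  smooth phi /\
  exists (r : R) nu (lambda : C^o -> C^o),
    [/\ 0 < r, sums_to phi r nu,
        forall t : C, 0 < `|t| < r%:C%C -> isomorphic (nu t) (h (lambda t)) &
        lambda t @[t --> (0 : C^o)^'] --> (lambda0 : C^o)].

End SmoothDeformations.

Section Algebras.
Variable K : comNzRingType.
Local Notation V := 'rV[K]_(2 + 4).

(* e 1, ..., e 6 *)
Let e (k : nat) : V := \row_j (j.+1 == k)%:R.

Definition g24_2 : V -> V -> V := @bracket_of K 2 4 (fun i j =>
  match (i : nat).+1, (j : nat).+1 with
  | 2, 4 => e 4
  | 2, 5 => e 3
  | 2, 6 => - e 6
  | 5, 5 => e 1
  | 4, 6 => e 1
  | _, _ => 0
  end).

Definition g24_3 (lambda : K) : V -> V -> V := @bracket_of K 2 4 (fun i j =>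
  match (i : nat).+1, (j : nat).+1 with
  | 2, 3 => e 3
  | 2, 4 => lambda *: e 4
  | 2, 5 => - e 5
  | 2, 6 => - lambda *: e 6
  | 3, 5 => e 1
  | 4, 6 => lambda *: e 1
  | _, _ => 0
  end).

End Algebras.

(* Main.v *)
From HB Require Import structures.
Require Import Defs.
From mathcomp Require Import all_boot all_order all_algebra.
From mathcomp Require Import complex ring.
From mathcomp Require Import all_classical all_reals all_analysis.
Import Order.TTheory GRing.Theory Num.Theory.
Import numFieldNormedType.Exports.
Local Open Scope ring_scope.

Set Implicit Arguments.
Unset Strict Implicit.
Unset Printing Implicit Defensive.

(* The deformation is phi_0 + t phi_1, in which e2 maps e5 to e3 and e3 to t e5;
   at t = l^2 the operator ad e2 has the eigenvalues 1, -1, l, -l on the odd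
   part, which gives g24_3(l).

   Let [ , ] be any metric deformation over C[[t]].  Invariance of the form makes
   the even part abelian, so ad e2 is skew for the bracket of odd elements.  The
   simple eigenvalues 1 and -1 of ad e2 at t = 0 lift to l and -l, with
   eigenvectors E4 and E6, and l^2 - (ad e2)^2 maps the odd part into the
   orthogonal complement of these.  There F5 = (l^2 - (ad e2)^2) e5 and
   F3 = [F2, F5], with F2 = e2 / l, satisfy [F2, F3] = p F3 + q F5, and the form
   forces p = 0.  F1 = [F5, F5] is a multiple of [E4, E6], hence central.  In the
   basis (F1, F2, F3, E4, F5, F6), with F6 proportional to E6, the bracket is the
   model with t replaced by q(t). *)

(** * Power series: the constant coefficient, the variable t, and t-adic fixed points *)

Section PowerSeries.
Variable K : comNzRingType.
Implicit Types (f g : fps K) (n : nat).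

Lemma fpsP f g : (forall n, f n = g n) -> f = g.
Proof. by move=> fg; apply/funext. Qed.

Lemma fps_coefD f g n : (f + g) n = f n + g n. Proof. by []. Qed.

Lemma fps_coefM f g n : (f * g) n = \sum_(i < n.+1) f i * g (n - i)%N.
Proof. by []. Qed.

Definition fps_const f : K := f 0%N.

Lemma fps_const_is_zmod_morphism : zmod_morphism fps_const.
Proof. by []. Qed.

Lemma fps_const_is_monoid_morphism : monoid_morphism fps_const.
Proof.
split=> // f g.
by rewrite /fps_const fps_coefM big_ord_recl big_ord0 addr0.
Qed.

HB.instance Definition _ := GRing.isZmodMorphism.Build _ _ fps_const
  fps_const_is_zmod_morphism.
HB.instance Definition _ := GRing.isMonoidMorphism.Build _ _ fps_const
  fps_const_is_monoid_morphism.

Lemma fpsC_is_zmod_morphism : zmod_morphism (@fpsC K).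
Proof.
move=> a b; apply: fpsP => -[|n] //=.
by rewrite fps_coefD /fpsC [(- _) _]/(- 0) subr0.
Qed.

Lemma fps_coefCM a f n : (fpsC a * f) n = a * f n.
Proof.
rewrite fps_coefM big_ord_recl /= subn0 big1 ?addr0 // => i _.
by rewrite mul0r.
Qed.

Lemma fpsC_is_monoid_morphism : monoid_morphism (@fpsC K).
Proof.
split=> // a b; apply: fpsP => -[|n]; rewrite fps_coefCM //=.
by rewrite mulr0.
Qed.

HB.instance Definition _ := GRing.isZmodMorphism.Build _ _ (@fpsC K)
  fpsC_is_zmod_morphism.
HB.instance Definition _ := GRing.isMonoidMorphism.Build _ _ (@fpsC K)
  fpsC_is_monoid_morphism.

Lemma fps_constK a : fps_const (fpsC a) = a. Proof. by []. Qed.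

Definition fpsX : fps K := fun n => (n == 1%N)%:R.

Lemma fpsX_mul0 f : (fpsX * f) 0%N = 0.
Proof. by rewrite fps_coefM big_ord_recl big_ord0 /fpsX mul0r addr0. Qed.

Lemma fpsX_mulS f n : (fpsX * f) n.+1 = f n.
Proof.
rewrite fps_coefM 2!big_ord_recl /= /fpsX mul0r add0r /= mul1r subSS subn0.
by rewrite big1 ?addr0 // => i _; rewrite mul0r.
Qed.

Lemma fpsX_const f : fps_const f = 0 -> {g | f = fpsX * g}.
Proof.
move=> f0; exists (fun n => f n.+1); apply: fpsP => -[|n].
  by rewrite fpsX_mul0.
by rewrite fpsX_mulS.
Qed.

Lemma mx_fpsX_const m n (M : 'M[fps K]_(m, n)) :
  map_mx fps_const M = 0 -> {N | M = fpsX *: N}.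
Proof.
move=> M0; have MX i j : {g | M i j = fpsX * g}.
  by apply: fpsX_const; move/matrixP/(_ i j): M0; rewrite !mxE.
by exists (\matrix_(i, j) sval (MX i j)); apply/matrixP => i j; rewrite !mxE;
  case: (MX i j).
Qed.

(** Congruence modulo t^n. *)
Definition fps_eq n f g := forall k, (k < n)%N -> f k = g k.

Lemma fps_eqD n f f' g g' :
  fps_eq n f f' -> fps_eq n g g' -> fps_eq n (f + g) (f' + g').
Proof. by move=> ff gg k kn; rewrite !fps_coefD ff ?gg. Qed.

Lemma fps_eqM n f f' g g' :
  fps_eq n f f' -> fps_eq n g g' -> fps_eq n (f * g) (f' * g').
Proof.
move=> ff gg k kn; rewrite !fps_coefM; apply: eq_bigr => i _.
rewrite ff ?gg //; first exact: leq_ltn_trans (leq_subr _ _) kn.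
by apply: leq_ltn_trans kn; rewrite -ltnS.
Qed.

Definition mx_eq n p q (M N : 'M[fps K]_(p, q)) :=
  forall i j, fps_eq n (M i j) (N i j).

Lemma mx_eqD n p q (M M' N N' : 'M[fps K]_(p, q)) :
  mx_eq n M M' -> mx_eq n N N' -> mx_eq n (M + N) (M' + N').
Proof. by move=> MM NN i j; rewrite !mxE; apply: fps_eqD. Qed.

Lemma mx_eqM n p q r (M M' : 'M[fps K]_(p, q)) (N N' : 'M[fps K]_(q, r)) :
  mx_eq n M M' -> mx_eq n N N' -> mx_eq n (M *m N) (M' *m N').
Proof.
move=> MM NN i j; rewrite !mxE.
by elim/big_ind2: _ => // [? ? ? ? |k _]; [apply: fps_eqD | apply: fps_eqM].
Qed.

Lemma mx_eqZ n p q f f' (M M' : 'M[fps K]_(p, q)) :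
  fps_eq n f f' -> mx_eq n M M' -> mx_eq n (f *: M) (f' *: M').
Proof. by move=> ff MM i j; rewrite !mxE; apply: fps_eqM. Qed.

(** The factor t makes [x |-> e + t Psi(x)] a contraction for the t-adic topology: each application
    gains one order of agreement, so the iterates starting from 0 converge coefficientwise. *)
Lemma fps_fixpoint p q (e : 'M[fps K]_(p, q))
    (Psi : 'M[fps K]_(p, q) -> 'M[fps K]_(p, q)) :
  (forall n M N, mx_eq n M N -> mx_eq n (Psi M) (Psi N)) ->
  exists x, x = e + fpsX *: Psi x.
Proof.
move=> PsiP; pose Phi x := e + fpsX *: Psi x.
have PhiP n M N : mx_eq n M N -> mx_eq n.+1 (Phi M) (Phi N).
  move=> MN i j; rewrite !mxE; apply: fps_eqD => // -[|k] kn.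
    by rewrite !fpsX_mul0.
  by rewrite !fpsX_mulS (PsiP _ _ _ MN).
pose u n := iter n Phi 0.
have uP n k : mx_eq n (u n) (u (n + k)%N).
  by elim: n => [|n IHn] // i j; rewrite addSn /u !iterS; apply: PhiP.
have uE n k i j : (k < n)%N -> u n i j k = u k.+1 i j k.
  by move=> kn; rewrite -(subnKC kn) -uP.
(* Coefficient n is stable from the iterate n+1 on, so the limit is read off along the diagonal. *)
pose x : 'M[fps K]_(p, q) := \matrix_(i, j) fun n => u n.+1 i j n.
have xu n : mx_eq n x (u n) by move=> i j k kn; rewrite mxE /= (uE n).
exists x; apply/matrixP => i j; apply: fpsP => n.
rewrite (xu n.+1) // -[RHS]/(Phi x i j n) /u iterS.
by apply: (PhiP n) => // i' j' k kn; rewrite (xu n).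
Qed.

End PowerSeries.

(** With f = c + t h, an inverse g solves g = c^-1 - t c^-1 h g, a fixed point equation for 1 x 1
    matrices. *)
Lemma fps_inverse (K : fieldType) (f : fps K) :
  fps_const f != 0 -> exists2 g, f * g = 1 & fps_const g = (fps_const f)^-1.
Proof.
set c := fps_const f => c0.
have [h fE] : {h | f - fpsC c = fpsX K * h}.
  by apply: fpsX_const; rewrite rmorphB /= fps_constK subrr.
have [|x xE] := @fps_fixpoint K 1 1 (const_mx (fpsC c^-1))
    (fun x => (- fpsC c^-1 * h) *: x).
  by move=> n M N; apply: mx_eqZ.
have := congr1 (fun M : 'M[fps K]_1 => M 0 0) xE; rewrite !mxE.
set g := x 0 0 => gE.
have cc : fpsC c * fpsC c^-1 = 1 by rewrite -rmorphM /= mulfV // rmorph1.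
have {}fE : f = fpsC c + fpsX K * h by rewrite -fE addrC subrK.
have fg : f * g = 1.
  transitivity (fpsC c * fpsC c^-1 * (1 - fpsX K * h * g) + fpsX K * h * g).
    by rewrite fE mulrDl {1}gE; ring.
  by rewrite cc mul1r subrK.
exists g => //; apply: (mulfI c0); rewrite mulfV //.
by rewrite -[RHS](rmorph1 (@fps_const K)) -fg rmorphM.
Qed.

(** * Homogeneous vectors, even bilinear maps, and brackets given by structure constants *)

Section Rows.
Variables (A : comNzRingType) (m n : nat).
Local Notation V := 'rV[A]_(m + n).
Implicit Types (br : V -> V -> V) (x y : V) (p q : bool) (i j : 'I_(m + n)).

Lemma homog0 p : homog p (0 : V).
Proof. by move=> i _; rewrite mxE. Qed.

Lemma homogD p x y : homog p x -> homog p y -> homog p (x + y).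
Proof. by move=> px py i ip; rewrite mxE px ?py ?addr0. Qed.

Lemma homogZ p a x : homog p x -> homog p (a *: x).
Proof. by move=> px i ip; rewrite mxE px ?mulr0. Qed.

Lemma homogN p x : homog p x -> homog p (- x).
Proof. by move=> px i ip; rewrite mxE px ?oppr0. Qed.

Lemma homog_sum (I : finType) (P : pred I) p (F : I -> V) :
  (forall a, P a -> homog p (F a)) -> homog p (\sum_(a | P a) F a).
Proof. by move=> pF; elim/big_ind: _ => // [|x y]; [exact: homog0|exact: homogD]. Qed.

Lemma homog_delta i : homog (parity i) (delta_mx 0 i : V).
Proof.
move=> j ij; rewrite mxE eqxx /=; case: eqP => [ji|//].
by rewrite ji eqxx in ij.
Qed.

Section Bilinear.
Variable br : V -> V -> V.
Hypothesis br_bilin : even_bilin br.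

Let brR x : linear (br x). Proof. by case: br_bilin. Qed.
Let brL y : linear (br^~ y). Proof. by case: br_bilin. Qed.

Lemma brDr x y z : br x (y + z) = br x y + br x z.
Proof. by have := brR x 1 y z; rewrite !scale1r. Qed.

Lemma brDl x y z : br (x + y) z = br x z + br y z.
Proof. by have := brL z 1 x y; rewrite /= !scale1r. Qed.

Lemma br0r x : br x 0 = 0.
Proof. by apply: (addIr (br x 0)); rewrite -brDr !add0r. Qed.

Lemma br0l x : br 0 x = 0.
Proof. by apply: (addIr (br 0 x)); rewrite -brDl !add0r. Qed.

Lemma brZr a x y : br x (a *: y) = a *: br x y.
Proof. by have := brR x a y 0; rewrite br0r !addr0. Qed.

Lemma brZl a x y : br (a *: x) y = a *: br x y.
Proof. by have := brL y a x 0; rewrite /= br0l !addr0. Qed.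

Lemma brNr x y : br x (- y) = - br x y.
Proof. by rewrite -scaleN1r brZr scaleN1r. Qed.

Lemma brNl x y : br (- x) y = - br x y.
Proof. by rewrite -scaleN1r brZl scaleN1r. Qed.

Lemma br_sumr (I : finType) x (F : I -> V) :
  br x (\sum_i F i) = \sum_i br x (F i).
Proof.
by apply: (big_morph (br x)) => [y z|]; [exact: brDr | exact: br0r].
Qed.

Lemma br_suml (I : finType) (F : I -> V) y :
  br (\sum_i F i) y = \sum_i br (F i) y.
Proof.
by apply: (big_morph (br^~ y)) => [x z|]; [exact: brDl | exact: br0l].
Qed.

Lemma homog_br p q x y : homog p x -> homog q y -> homog (p (+) q) (br x y).
Proof. by case: br_bilin => _ _; apply. Qed.

End Bilinear.

(** Bilinearity and super-skew-symmetry reduce the comparison to pairs of rows with i <= j. This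
    turns a table of brackets in a new basis, the rows of [M], into an intertwining relation. *)
Lemma bracket_of_rows br (c : 'I_(m + n) -> 'I_(m + n) -> V) (M : 'M[A]_(m + n)) :
  even_bilin br -> super_skew br ->
  (forall i, homog (parity i) (row i M)) ->
  (forall i j, (i <= j)%N -> br (row i M) (row j M) = c i j *m M) ->
  forall x y, br (x *m M) (y *m M) = bracket_of c x y *m M.
Proof.
move=> brE brS Mh brM x y; rewrite /bracket_of mulmx_suml !mulmx_sum_row.
rewrite br_suml //; apply: eq_bigr => i _; rewrite br_sumr // mulmx_suml.
apply: eq_bigr => j _; rewrite brZl // brZr // scalerA -scalemxAl; congr (_ *: _).
case: leqP => ij; first by rewrite brM.
rewrite (brS (parity j) (parity i)) ?brM //; last exact: ltnW.
by rewrite mulNmx -scalemxAl andbC.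
Qed.

Lemma bracket_of_bilin (c : 'I_(m + n) -> 'I_(m + n) -> V) :
  (forall i j, homog (parity i (+) parity j) (c i j)) ->
  even_bilin (bracket_of c).
Proof.
move=> ch; rewrite /bracket_of; split.
- move=> x a y z; rewrite scaler_sumr -big_split; apply: eq_bigr => i _ /=.
  rewrite scaler_sumr -big_split; apply: eq_bigr => j _ /=.
  by rewrite scalerA -scalerDl !mxE; congr (_ *: _); ring.
- move=> z a x y; rewrite scaler_sumr -big_split; apply: eq_bigr => i _ /=.
  rewrite scaler_sumr -big_split; apply: eq_bigr => j _ /=.
  by rewrite scalerA -scalerDl !mxE; congr (_ *: _); ring.
- move=> p q x y px qy; apply: homog_sum => i _; apply: homog_sum => j _.
  have [ip|ip] := eqVneq (parity i) p; last first.
    by rewrite px // mul0r scale0r; apply: homog0.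
  have [jq|jq] := eqVneq (parity j) q; last first.
    by rewrite qy // mulr0 scale0r; apply: homog0.
  apply: homogZ; rewrite -ip -jq; case: leqP => _; first exact: ch.
  by apply/homogN/homogZ; rewrite addbC.
Qed.

(** The diagonal is constrained only at even indices: for an odd vector the two signs cancel and the
    rule is symmetric. *)
Lemma bracket_of_skew (c : 'I_(m + n) -> 'I_(m + n) -> V) :
  (forall i, ~~ parity i -> c i i = 0) -> super_skew (bracket_of c).
Proof.
move=> c0 p q x y px qy; rewrite /bracket_of exchange_big /=.
rewrite scaler_sumr -sumrN; apply: eq_bigr => i _.
rewrite scaler_sumr -sumrN; apply: eq_bigr => j _.
have [ip|ip] := eqVneq (parity i) p; last first.
  by rewrite px // mulr0 mul0r !scale0r scaler0 oppr0.
have [jq|jq] := eqVneq (parity j) q; last first.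
  by rewrite qy // mulr0 mul0r !scale0r scaler0 oppr0.
have sN (a b : A) (v : V) : - (a *: (b *: v)) = b *: - (a *: v).
  by rewrite scalerN !scalerA mulrC.
rewrite -ip -jq [y 0 j * _]mulrC sN; congr (_ *: _); case: (ltngtP i j) => ij.
- by rewrite andbC.
- by rewrite scalerN scalerA opprK -expr2 sqrr_sign scale1r.
- have -> : j = i by apply: val_inj.
  case: (boolP (parity i)) => pi /=; first by rewrite scaleN1r opprK.
  by rewrite c0 // scaler0 oppr0.
Qed.

End Rows.

(** * Coordinates in rank 2|4 *)

Definition o1 : 'I_(2 + 4) := @Ordinal (2 + 4) 0 isT.
Definition o2 : 'I_(2 + 4) := @Ordinal (2 + 4) 1 isT.
Definition o3 : 'I_(2 + 4) := @Ordinal (2 + 4) 2 isT.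
Definition o4 : 'I_(2 + 4) := @Ordinal (2 + 4) 3 isT.
Definition o5 : 'I_(2 + 4) := @Ordinal (2 + 4) 4 isT.
Definition o6 : 'I_(2 + 4) := @Ordinal (2 + 4) 5 isT.

Lemma ord6_ind (P : 'I_(2 + 4) -> Prop) :
  P o1 -> P o2 -> P o3 -> P o4 -> P o5 -> P o6 -> forall i, P i.
Proof.
move=> P1 P2 P3 P4 P5 P6 i.
have Pi j : P j -> i = j :> nat -> P i by move=> Pj /val_inj ->.
case: (i : nat) (ltn_ord i) Pi => [|[|[|[|[|[|//]]]]]] _ Pi;
  by [apply: Pi P1 _ | apply: Pi P2 _ | apply: Pi P3 _ |
      apply: Pi P4 _ | apply: Pi P5 _ | apply: Pi P6 _].
Qed.

Lemma sum6 (V' : nmodType) (F : 'I_(2 + 4) -> V') :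
  \sum_i F i = F o1 + (F o2 + (F o3 + (F o4 + (F o5 + F o6)))).
Proof.
rewrite !big_ord_recl big_ord0 addr0.
by do !(congr (_ + _)); congr (F _); apply: val_inj.
Qed.

Ltac bracket_coords :=
  rewrite /bracket_of !summxE;
  under eq_bigr => i _ do rewrite summxE;
  under eq_bigr => i _ do under eq_bigr => j _ do rewrite mxE;
  rewrite !sum6 /= !mxE /=; ring.

(** * The model brackets and their invariant form *)

Section Model.
Variable A : comNzRingType.
Local Notation V := 'rV[A]_(2 + 4).
Implicit Types (x y z : V) (a q : A).

Lemma row6P x y : x 0 o1 = y 0 o1 -> x 0 o2 = y 0 o2 -> x 0 o3 = y 0 o3 ->
  x 0 o4 = y 0 o4 -> x 0 o5 = y 0 o5 -> x 0 o6 = y 0 o6 -> x = y.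
Proof. by move=> *; apply/rowP; apply: ord6_ind. Qed.

Lemma homog_even x : homog false x ->
  [/\ x 0 o3 = 0, x 0 o4 = 0, x 0 o5 = 0 & x 0 o6 = 0].
Proof. by move=> hx; split; apply: hx. Qed.

Lemma homog_odd x : homog true x -> x 0 o1 = 0 /\ x 0 o2 = 0.
Proof. by move=> hx; split; apply: hx. Qed.

Lemma homog_evenP x : x 0 o3 = 0 -> x 0 o4 = 0 -> x 0 o5 = 0 -> x 0 o6 = 0 ->
  homog false x.
Proof. by move=> *; apply: ord6_ind. Qed.

Lemma homog_oddP x : x 0 o1 = 0 -> x 0 o2 = 0 -> homog true x.
Proof. by move=> *; apply: ord6_ind. Qed.

Lemma homog_evenE x : homog false x ->
  x = x 0 o1 *: delta_mx 0 o1 + x 0 o2 *: delta_mx 0 o2.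
Proof.
move=> /homog_even[x3 x4 x5 x6]; apply: row6P; rewrite !mxE /=.
- by rewrite mulr1 mulr0 addr0.
- by rewrite mulr1 mulr0 add0r.
- by rewrite x3 !mulr0 addr0.
- by rewrite x4 !mulr0 addr0.
- by rewrite x5 !mulr0 addr0.
- by rewrite x6 !mulr0 addr0.
Qed.

(* For (a, q) = (1, t) this is the deformation in which ad e2 maps e5 to e3 and
   e3 to t e5; linearity in (a, q) lets the same formula describe the
   coefficients of the power series. *)
Definition coef_g24 a q (i j : 'I_(2 + 4)) : V :=
  match (i : nat).+1, (j : nat).+1 with
  | 2, 3 => q *: delta_mx 0 o5
  | 2, 4 => a *: delta_mx 0 o4
  | 2, 5 => a *: delta_mx 0 o3
  | 2, 6 => - a *: delta_mx 0 o6
  | 3, 3 => - q *: delta_mx 0 o1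
  | 4, 6 => a *: delta_mx 0 o1
  | 5, 5 => a *: delta_mx 0 o1
  | _, _ => 0
  end.

Definition g24_def a q : V -> V -> V := bracket_of (coef_g24 a q).

Lemma g24_def1 a q x y : g24_def a q x y 0 o1 =
  a * (x 0 o5 * y 0 o5) + a * (x 0 o4 * y 0 o6) + a * (x 0 o6 * y 0 o4)
  + (- q) * (x 0 o3 * y 0 o3).
Proof. rewrite /g24_def; bracket_coords. Qed.

Lemma g24_def2 a q x y : g24_def a q x y 0 o2 = 0.
Proof. rewrite /g24_def; bracket_coords. Qed.

Lemma g24_def3 a q x y : g24_def a q x y 0 o3 =
  a * (x 0 o2 * y 0 o5) + (- a) * (x 0 o5 * y 0 o2).
Proof. rewrite /g24_def; bracket_coords. Qed.

Lemma g24_def4 a q x y : g24_def a q x y 0 o4 =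
  a * (x 0 o2 * y 0 o4) + (- a) * (x 0 o4 * y 0 o2).
Proof. rewrite /g24_def; bracket_coords. Qed.

Lemma g24_def5 a q x y : g24_def a q x y 0 o5 =
  q * (x 0 o2 * y 0 o3) + (- q) * (x 0 o3 * y 0 o2).
Proof. rewrite /g24_def; bracket_coords. Qed.

Lemma g24_def6 a q x y : g24_def a q x y 0 o6 =
  a * (x 0 o6 * y 0 o2) + (- a) * (x 0 o2 * y 0 o6).
Proof. rewrite /g24_def; bracket_coords. Qed.

Definition g24_defE :=
  (g24_def1, g24_def2, g24_def3, g24_def4, g24_def5, g24_def6).

Lemma g24_defZ a q x y :
  g24_def a q x y = a *: g24_def 1 0 x y + q *: g24_def 0 1 x y.
Proof. by apply: row6P; rewrite !mxE !g24_defE; ring. Qed.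

Lemma g24_2E : @g24_2 A = g24_def 1 0.
Proof.
apply/funext => x; apply/funext => y.
by apply: row6P; rewrite g24_defE /g24_2; bracket_coords.
Qed.

Lemma coef_g24_homog a q i j : homog (parity i (+) parity j) (coef_g24 a q i j).
Proof.
by move: i j; do 2!apply: ord6_ind; rewrite /coef_g24 /=;
  apply: ord6_ind => //= _; rewrite !mxE /= ?mulr0.
Qed.

Lemma g24_def_bilin a q : even_bilin (g24_def a q).
Proof. exact/bracket_of_bilin/coef_g24_homog. Qed.

Lemma g24_def_skew a q : super_skew (g24_def a q).
Proof. by apply: bracket_of_skew; apply: ord6_ind. Qed.

Lemma g24_def_jacobi a q : super_jacobi (g24_def a q).
Proof.
move=> p r x y z.
(* The parities of x and y make some of their coordinates vanish; every case is then a polynomial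
   identity in the remaining ones, with z arbitrary. *)
have hP (b : bool) (u : V) : homog b u -> if b then u 0 o1 = 0 /\ u 0 o2 = 0 else
    [/\ u 0 o3 = 0, u 0 o4 = 0, u 0 o5 = 0 & u 0 o6 = 0].
  by case: b; [exact: homog_odd | exact: homog_even].
move=> /hP + /hP; case: p; case: r => /= hx hy.
- case: hx => x1 x2; case: hy => y1 y2.
  by apply: row6P; rewrite !mxE !g24_defE ?x1 ?x2 ?y1 ?y2; ring.
- case: hx => x1 x2; case: hy => y1 y2 y3 y4.
  by apply: row6P; rewrite !mxE !g24_defE ?x1 ?x2 ?y1 ?y2 ?y3 ?y4; ring.
- case: hx => x1 x2 x3 x4; case: hy => y1 y2.
  by apply: row6P; rewrite !mxE !g24_defE ?x1 ?x2 ?x3 ?x4 ?y1 ?y2; ring.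
- case: hx => x1 x2 x3 x4; case: hy => y1 y2 y3 y4.
  by apply: row6P; rewrite !mxE !g24_defE ?x1 ?x2 ?x3 ?x4 ?y1 ?y2 ?y3 ?y4; ring.
Qed.

Lemma g24_def_lie a q : lie_superalgebra (g24_def a q).
Proof.
by split; [exact: g24_def_bilin | exact: g24_def_skew | exact: g24_def_jacobi].
Qed.

(** The pair e1, e2 is hyperbolic, and e3, e5 and e4, e6 are symplectic pairs. The same form serves
    all values of (a, q). *)
Definition form24 x y : A :=
  x 0 o1 * y 0 o2 + x 0 o2 * y 0 o1 + x 0 o3 * y 0 o5 - x 0 o5 * y 0 o3
  + x 0 o4 * y 0 o6 - x 0 o6 * y 0 o4.

Lemma form24_metric a q : metric_form (g24_def a q) form24.
Proof.
split.
- by split=> [x b y z|y b x z]; rewrite /form24 !mxE /=; ring.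
- move=> [] [] x y // hx hy _; rewrite /form24.
  + by have [-> ->] := homog_odd hx; have [-> -> -> ->] := homog_even hy; ring.
  + by have [-> ->] := homog_odd hy; have [-> -> -> ->] := homog_even hx; ring.
- move=> [] [] x y hx hy; rewrite /form24.
  + by have [-> ->] := homog_odd hx; have [-> ->] := homog_odd hy; rewrite /=; ring.
  + by have [-> ->] := homog_odd hx; have [-> -> -> ->] := homog_even hy;
      rewrite /=; ring.
  + by have [-> ->] := homog_odd hy; have [-> -> -> ->] := homog_even hx;
      rewrite /=; ring.
  + by have [-> -> -> ->] := homog_even hx; have [-> -> -> ->] := homog_even hy;
      rewrite /=; ring.
- by move=> x y z; rewrite /form24 !g24_defE; ring.
- move=> L; pose l i := L (delta_mx 0 i).
  have LE y : L y = y 0 o1 * l o1 + y 0 o2 * l o2 + y 0 o3 * l o3 +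
      y 0 o4 * l o4 + y 0 o5 * l o5 + y 0 o6 * l o6.
    rewrite {1}(row_sum_delta y) linear_sum sum6 !linearZ /= -!/(l _).
    by rewrite !addrA.
  (* The vector representing [L], written in the dual basis; the minus signs come from B(e5, e3) =
     B(e6, e4) = -1. *)
  exists (l o2 *: delta_mx 0 o1 + l o1 *: delta_mx 0 o2 + l o5 *: delta_mx 0 o3
    + l o6 *: delta_mx 0 o4 - l o3 *: delta_mx 0 o5 - l o4 *: delta_mx 0 o6).
  split=> [y|x xL].
    by rewrite LE /form24 !mxE /=; ring.
  by apply: row6P; rewrite !mxE /= /l -!xL /form24 !mxE /=; ring.
Qed.

Lemma g24_def_metric a q : metric_lie_superalgebra (g24_def a q).
Proof. by split; [exact: g24_def_lie | exists form24; exact: form24_metric]. Qed.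

End Model.

(** * The model as a power series of brackets *)

Section ModelSeries.
Variable K : comNzRingType.
Implicit Types (f g h : fps K).

Lemma fps_coefM3 f g h n :
  (f * (g * h)) n = \sum_(i < n.+1) \sum_(j < (n - i).+1) f i * (g j * h (n - i - j)%N).
Proof. by rewrite fps_coefM; apply: eq_bigr => i _; rewrite fps_coefM mulr_sumr. Qed.

(** Each coordinate of the model bracket is linear in (a, q), in x and in y, so the convolution
    defining [ext_bracket] is the triple product in K[[t]]. *)
Lemma ext_g24_def f g : ext_bracket (fun n => g24_def (f n) (g n)) = g24_def f g.
Proof.
apply/funext => x; apply/funext => y.
apply: row6P; rewrite g24_defE mxE; apply: fpsP => n;
  rewrite summxE ?fps_coefD ?fps_coefM3 -?big_split.
- apply: eq_bigr => i _; rewrite summxE -!big_split; apply: eq_bigr => j _.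
  by rewrite g24_defE !mxE.
- rewrite big1 // => i _; rewrite summxE big1 // => j _.
  by rewrite g24_defE.
all: apply: eq_bigr => i _; rewrite summxE -!big_split; apply: eq_bigr => j _;
  by rewrite g24_defE !mxE.
Qed.

(** The coefficients of the model at (1, t); those of order at least 2 vanish. *)
Definition g24_series (n : nat) := @g24_def K ((1 : fps K) n) (fpsX K n).

(** The model is affine in t, so only the powers f^0 and f^1 contribute and t is simply replaced by
    f. *)
Lemma reparam_g24_series f : f 0%N = 0 ->
  reparam f g24_series = fun n => g24_def ((1 : fps K) n) (f n).
Proof.
move=> f0; apply/funext => -[|n]; apply/funext => x; apply/funext => y.
  rewrite /reparam big_ord_recl big_ord0 expr0 addr0 /g24_series f0.
  by rewrite -[(1 : fps K) 0%N]/(1 : K) scale1r.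
rewrite /reparam 2!big_ord_recl big1 => [|i _]; last first.
  by rewrite /g24_series g24_defZ !scale0r addr0 scaler0.
rewrite expr0 expr1 addr0 scale0r add0r [RHS]g24_defZ [(1 : fps K) n.+1]/(0 : K).
by rewrite /g24_series scale0r add0r.
Qed.

End ModelSeries.

(** * Equivalences of deformations as matrices over K[[t]] *)

Section EquivalenceMatrix.
Variables (K : fieldType) (m n : nat).
Local Notation V := 'rV[K]_(m + n).
Local Notation Vt := 'rV[fps K]_(m + n).
Implicit Types (M N : 'M[fps K]_(m + n)).

Lemma fps_coef_sum (I : finType) (F : I -> fps K) k : (\sum_i F i) k = \sum_i F i k.
Proof. by apply: (big_morph (fun f : fps K => f k)). Qed.

(** The determinant has constant coefficient 1, hence is a unit, and the adjugate gives the
    inverse. *)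
Lemma mx_const1_invertible M : map_mx (@fps_const K) M = 1%:M ->
  exists2 N, M *m N = 1%:M & N *m M = 1%:M.
Proof.
move=> M1; have := congr1 determinant M1; rewrite det_map_mx det1 => dM.
have [d dE _] : exists2 g, \det M * g = 1 & fps_const g = (fps_const (\det M))^-1.
  by apply: fps_inverse; rewrite dM oner_eq0.
exists (d *: \adj M).
  by rewrite -scalemxAr mul_mx_adj scale_scalar_mx mulrC dE.
by rewrite -scalemxAl mul_adj_mx scale_scalar_mx mulrC dE.
Qed.

Lemma mulmx_homog (A : comNzRingType) (M : 'M[A]_(m + n)) p (x : 'rV_(m + n)) :
  (forall i, homog (parity i) (row i M)) -> homog p x -> homog p (x *m M).
Proof.
move=> Mh px; rewrite mulmx_sum_row; apply: homog_sum => i _.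
have [<-|/px->] := eqVneq (parity i) p; first exact: homogZ.
by rewrite scale0r; apply: homog0.
Qed.

(** The component of x of the wrong parity is sent to a vector that has both parities, hence to 0,
    and [M] is injective. *)
Lemma homog_mulmx_inv (A : comNzRingType) (M N : 'M[A]_(m + n)) p (x : 'rV_(m + n)) :
  (forall i, homog (parity i) (row i M)) -> M *m N = 1%:M ->
  homog p (x *m M) -> homog p x.
Proof.
move=> Mh MN pxM.
pose pr r : 'rV[A]_(m + n) := \row_j if parity j == r then x 0 j else 0.
have prh r : homog r (pr r) by move=> i /negPf; rewrite mxE => ->.
have xE : x = pr p + pr (~~ p).
  apply/rowP => j; rewrite !mxE.
  by case: (parity j) (p) => [] []; rewrite ?addr0 ?add0r.
have z0 : pr (~~ p) *m M = 0.
  apply/rowP => j; rewrite [RHS]mxE.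
  have [jp|/eqP jp] := eqVneq (parity j) (~~ p); last first.
    by apply: (mulmx_homog Mh (prh (~~ p))); apply/eqP.
  have := pxM j; rewrite {1}xE mulmxDl mxE (mulmx_homog Mh (prh p)) ?add0r; last first.
    by rewrite jp; case: (p).
  by apply; rewrite jp; case: (p).
suff -> : x = pr p by [].
by rewrite [LHS]xE -[pr (~~ p)]mulmx1 -MN mulmxA z0 mul0mx addr0.
Qed.

Lemma ext_lin_mx N (x : Vt) :
  ext_lin (fun k (y : V) => y *m map_mx (fun f : fps K => f k) N) x = x *m N.
Proof.
apply/rowP => j; rewrite !mxE; apply: fpsP => k; rewrite summxE fps_coef_sum.
under eq_bigr => i _ do rewrite !mxE.
rewrite exchange_big /=; apply: eq_bigr => a _; rewrite mulrC fps_coefM.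
by apply: eq_bigr => i _; rewrite !mxE mulrC.
Qed.

(** The rows of [M] are a basis in which [phi] looks like [phi'], so the equivalence from [phi] to
    [phi'] is multiplication by the inverse of [M], taken coefficient by coefficient. *)
Lemma equivalent_mx (phi phi' : nat -> V -> V -> V) M :
  map_mx (@fps_const K) M = 1%:M ->
  (forall i, homog (parity i) (row i M)) ->
  (forall x y, ext_bracket phi (x *m M) (y *m M) = ext_bracket phi' x y *m M) ->
  equivalent phi phi'.
Proof.
move=> M1 Mh Mbr; have [N MN NM] := mx_const1_invertible M1.
exists (fun k (y : V) => y *m map_mx (fun f : fps K => f k) N); split.
- apply/funext => y; suff -> : map_mx (fun f : fps K => f 0%N) N = 1%:M by rewrite mulmx1.
  rewrite -[LHS]/(map_mx (@fps_const K) N) -[LHS]mul1mx -M1 -map_mxM MN M1.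
  exact: map_mx1.
- move=> k; split=> [a x y|p x px]; first by rewrite mulmxDl scalemxAl.
  apply: mulmx_homog => // i j ij; rewrite !mxE.
  have /(_ j ij) : homog (parity i) (row i N).
    by apply: (homog_mulmx_inv Mh MN); rewrite -row_mul NM row1; apply: homog_delta.
  by rewrite mxE => ->.
- move=> x y; rewrite !ext_lin_mx; set X := vconst x; set Y := vconst y.
  by rewrite -{1}[X]mulmx1 -{1}[Y]mulmx1 -NM !mulmxA Mbr -mulmxA MN mulmx1.
Qed.

End EquivalenceMatrix.

(** * The model deformation is metric and nontrivial *)

Section ModelDeformation.
Variable K : comNzRingType.

Lemma ext_g24_series : ext_bracket (@g24_series K) = g24_def 1 (fpsX K).
Proof. by rewrite -ext_g24_def. Qed.

Lemma g24_series_metric : metric_deformation (@g24_2 K) (@g24_series K).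
Proof.
rewrite /metric_deformation /deformation ext_g24_series; split; last first.
  exact: g24_def_metric.
split; last exact: g24_def_lie.
  by rewrite g24_2E.
by move=> i; split; [exact: g24_def_bilin | exact: g24_def_skew].
Qed.

(** At order t an equivalence would send the term t e5 of [e2, e3] to a vector with e5-coordinate 1,
    while no bracket of the undeformed algebra has an e5-component. *)
Lemma g24_series_nontrivial : ~ trivial_deformation (@g24_2 K) (@g24_series K).
Proof.
pose e i : 'rV[K]_(2 + 4) := delta_mx 0 i.
case=> psi [psi0 psiE /(_ (e o2) (e o3))].
have -> : (fun i => if i is 0%N then @g24_2 K else fun _ _ => 0) =
    (fun i => g24_def ((1 : fps K) i) ((0 : fps K) i)).
  apply/funext => -[|i]; first by rewrite g24_2E.
  apply/funext => x; apply/funext => y.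
  by rewrite g24_defZ !scale0r addr0.
rewrite ext_g24_def ext_g24_series.
move/(congr1 (fun x : 'rV[fps K]_(2 + 4) => x 0 o5 1%N)).
rewrite g24_def5 oppr0 !mul0r addr0.
have -> : g24_def 1 (fpsX K) (vconst (e o2)) (vconst (e o3)) =
    fpsX K *: vconst (e o5).
  by apply: row6P; rewrite g24_defE !mxE /= !(rmorph0, rmorph1); ring.
rewrite mxE 2!big_ord_recl big_ord0 addr0 /= psi0 !mxE /= -[RHS]/(0 : K).
(* At order 1, [psi 1] only meets the constant term of t e5, which is 0. *)
have -> : vcoef (1 - 1) (fpsX K *: vconst (e o5)) = 0.
  by apply/rowP => j; rewrite !mxE fpsX_mul0.
have -> : psi 1%N 0 = 0.
  have [lin _] := psiE 1%N; apply: (addIr (psi 1%N 0)).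
  by have := lin 1 0 0; rewrite !scale1r !addr0 add0r => <-.
rewrite mxE addr0 subn0 -[1%N]/(0.+1) fpsX_mulS /= => /eqP.
by rewrite oner_eq0.
Qed.

End ModelDeformation.

(** * Lifting eigenvectors from t = 0 to power series *)

Section EigenvectorLifting.
Variable K : comNzRingType.
Local Notation A := (fps K).

(* S is a partial inverse of D0 - c, so that the equation x (D - c) = r x with
   x_k = 1 becomes a fixed point equation whose right-hand side has a factor t. *)
Lemma eigenvector_lift n (D D0 S : 'M[A]_n) (e : 'rV[A]_n) (c : A) (k : 'I_n) :
  map_mx (@fps_const K) D = map_mx (@fps_const K) D0 ->
  e 0 k = 1 -> (forall v : 'rV_n, (v *m S) 0 k = 0) ->
  e *m D0 = c *: e ->
  (forall v : 'rV_n, v *m S *m D0 - c *: (v *m S) = v - v 0 k *: e) ->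
  exists x l, [/\ x *m D = l *: x,
    map_mx (@fps_const K) x = map_mx (@fps_const K) e & fps_const l = fps_const c].
Proof.
move=> DD0 ek Sk eD0 SD0.
have [D1 D1E] : {N | D - D0 = fpsX K *: N}.
  by apply: mx_fpsX_const; rewrite map_mxB DD0 subrr.
(* For D = D0 + t D1 and x_k = 1, the eigenvalue must be c + t (x D1)_k, and the equation becomes x
   (D0 - c) = t r(x). Since r(x)_k = 0, the partial inverse [S] solves it by x = e + t r(x) S. *)
pose r (x : 'rV[A]_n) : 'rV[A]_n := (x *m D1) 0 k *: x + x *m (- D1).
have [|x xE] := @fps_fixpoint K 1 n e (fun x => r x *m S).
  move=> m M N MN; apply: mx_eqM => //; apply: mx_eqD; last exact: mx_eqM.
  by apply: mx_eqZ => //; apply: mx_eqM.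
have xk : x 0 k = 1 by rewrite xE mxE ek [X in _ + X]mxE Sk mulr0 addr0.
exists x, (c + fpsX K * (x *m D1) 0 k); split.
- have rk : r x 0 k = 0 by rewrite mxE [X in X + _]mxE xk mulr1 mulmxN [X in _ + X]mxE subrr.
  have : x *m D0 - c *: x = fpsX K *: r x.
    rewrite {1 2}xE mulmxDl -scalemxAl eD0 scalerDr opprD addrACA subrr add0r.
    by rewrite [c *: (_ *: _)]scalerA [c * _]mulrC -scalerA -scalerBr SD0 rk scale0r subr0.
  move/eqP; rewrite subr_eq => /eqP xD0.
  rewrite -(subrK D0 D) D1E mulmxDr xD0 -scalemxAr addrA -scalerDr addrC scalerDl.
  by rewrite /r mulmxN addrCA subrr addr0 scalerA.
- apply/matrixP => i j; rewrite {1}xE !mxE rmorphD /= /fps_const fpsX_mul0.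
  by rewrite addr0.
- by rewrite rmorphD /= {2}/fps_const fpsX_mul0 addr0.
Qed.

End EigenvectorLifting.

(** * The matrix of ad h on row vectors, and the lifts of the eigenvalues 1 and -1 *)

Section Ad.
Variable A : comNzRingType.

Definition admx m n (br : 'rV[A]_(m + n) -> 'rV[A]_(m + n) -> 'rV[A]_(m + n)) h :
  'M[A]_(m + n) := \matrix_i br h (delta_mx 0 i).

Lemma mul_admx m n br h (x : 'rV[A]_(m + n)) :
  even_bilin br -> x *m admx br h = br h x.
Proof.
move=> brE; rewrite mulmx_sum_row {2}(row_sum_delta x) br_sumr //.
by apply: eq_bigr => i _; rewrite rowK brZr.
Qed.

End Ad.

Lemma map_g24_def (A A' : comNzRingType) (f : {rmorphism A -> A'}) a q x y :
  map_mx f (g24_def a q x y) = g24_def (f a) (f q) (map_mx f x) (map_mx f y).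
Proof.
by apply: row6P; rewrite [LHS]mxE !g24_defE ?mxE ?(rmorphD, rmorphM, rmorphN, rmorph0).
Qed.

Section ModelEigen.
Variable K : numFieldType.
Local Notation A := (fps K).
Local Notation e := (delta_mx 0 : 'I_(2 + 4) -> 'rV[A]_(2 + 4)).
Let half : A := fpsC 2^-1.

Lemma fps_half (f : A) : half * f + half * f = f.
Proof.
have hh : half + half = 1.
  by rewrite /half -rmorphD /= -mulr2n -[_ *+ 2]mulr_natr mulVf ?pnatr_eq0 // rmorph1.
by rewrite -mulrDl hh mul1r.
Qed.

Lemma eigen4 (D : 'M[A]_(2 + 4)) :
  map_mx (@fps_const K) D = map_mx (@fps_const K) (admx (g24_def 1 0) (e o2)) ->
  exists x l, [/\ x *m D = l *: x,
    map_mx (@fps_const K) x = map_mx (@fps_const K) (e o4) & fps_const l = 1].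
Proof.
(* [S] inverts ad e2 - 1 off e4: it is -1 on e1 and e2, -(1 + N) on the nilpotent block N : e5 ->
   e3, and -1/2 on e6. *)
pose S : 'M[A]_(2 + 4) := \matrix_(i, j) match (i : nat).+1, (j : nat).+1 with
  | 1, 1 | 2, 2 | 3, 3 | 5, 5 | 5, 3 => -1 | 6, 6 => - half | _, _ => 0 end.
move=> DD0; rewrite -(rmorph1 (@fps_const K)).
apply: (eigenvector_lift (S := S) (k := o4)) DD0 _ _ _ _.
- by rewrite mxE.
- by move=> v; rewrite mxE sum6 !mxE /=; ring.
- rewrite mul_admx; last exact: g24_def_bilin.
  by apply: row6P; rewrite !g24_defE ?mxE /=; ring.
- move=> v; rewrite mul_admx; last exact: g24_def_bilin.
  apply: row6P; rewrite [LHS]mxE g24_defE ?[(v *m S) _ _]mxE ?sum6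
    !mxE ?sum6 !mxE /=; first [ring | idtac].
  by rewrite -[in RHS](fps_half (v 0 o6)); ring.
Qed.

Lemma eigen6 (D : 'M[A]_(2 + 4)) :
  map_mx (@fps_const K) D = map_mx (@fps_const K) (admx (g24_def 1 0) (e o2)) ->
  exists x l, [/\ x *m D = l *: x,
    map_mx (@fps_const K) x = map_mx (@fps_const K) (e o6) & fps_const l = -1].
Proof.
(* [S] inverts ad e2 + 1 off e6: it is 1 on e1 and e2, 1 - N on the block N : e5 -> e3, and 1/2 on
   e4. *)
pose S : 'M[A]_(2 + 4) := \matrix_(i, j) match (i : nat).+1, (j : nat).+1 with
  | 1, 1 | 2, 2 | 3, 3 | 5, 5 => 1 | 5, 3 => -1 | 4, 4 => half | _, _ => 0 end.
move=> DD0; rewrite -(rmorphN1 (@fps_const K)).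
apply: (eigenvector_lift (S := S) (k := o6)) DD0 _ _ _ _.
- by rewrite mxE.
- by move=> v; rewrite mxE sum6 !mxE /=; ring.
- rewrite mul_admx; last exact: g24_def_bilin.
  by apply: row6P; rewrite !g24_defE ?mxE /=; ring.
- move=> v; rewrite mul_admx; last exact: g24_def_bilin.
  apply: row6P; rewrite [LHS]mxE g24_defE ?[(v *m S) _ _]mxE ?sum6
    !mxE ?sum6 !mxE /=; first [ring | idtac].
  by rewrite -[in RHS](fps_half (v 0 o4)); ring.
Qed.

End ModelEigen.

(** * Cancellation of units and of integers in K[[t]] *)

Section Units.
Variable K : numFieldType.
Local Notation A := (fps K).

Lemma fps_unit_scale_eq0 (f : A) m n (M : 'M[A]_(m, n)) :
  fps_const f != 0 -> f *: M = 0 -> M = 0.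
Proof.
move=> /fps_inverse[g fg _] fM.
by rewrite -[M]scale1r -fg mulrC -scalerA fM scaler0.
Qed.

Lemma fps_unit_eq0 (f g : A) : fps_const f != 0 -> g * f = 0 -> g = 0.
Proof.
move=> /fps_inverse[h fh _] gf.
by rewrite -[g]mulr1 -fh mulrA gf mul0r.
Qed.

Lemma fps_muln_eq0 m n k (M : 'M[A]_(m, n)) : M *+ k.+1 = 0 -> M = 0.
Proof.
rewrite -scaler_nat; apply: fps_unit_scale_eq0.
by rewrite rmorph_nat pnatr_eq0.
Qed.

Lemma fps_eq_opp_eq0 m n (M : 'M[A]_(m, n)) : M = - M -> M = 0.
Proof. by move=> MN; apply: (@fps_muln_eq0 _ _ 1); rewrite mulr2n {1}MN addNr. Qed.

End Units.

(** * Skew-symmetry and Jacobi identity sorted by parity *)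

Section LieRules.
Variables (A : comNzRingType) (br : 'rV[A]_(2 + 4) -> 'rV[A]_(2 + 4) -> 'rV[A]_(2 + 4)).
Hypotheses (brS : super_skew br) (brJ : super_jacobi br).
Implicit Types x y z : 'rV[A]_(2 + 4).

Lemma br_oddC x y : homog true x -> homog true y -> br y x = br x y.
Proof. by move=> hx hy; rewrite (brS hx hy) /= scaleN1r opprK. Qed.

Lemma br_evenC p x y : homog false x -> homog p y -> br y x = - br x y.
Proof. by move=> hx hy; rewrite (brS hx hy) /= scale1r. Qed.

Lemma br_even_der p x y z : homog false x -> homog p y ->
  br x (br y z) = br (br x y) z + br y (br x z).
Proof. by move=> hx hy; rewrite (brJ _ hx hy) /= scale1r. Qed.

Lemma br_odd_jacobi x y z : homog true x -> homog true y ->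
  br x (br y z) = br (br x y) z - br y (br x z).
Proof. by move=> hx hy; rewrite (brJ _ hx hy) /= scaleN1r. Qed.

End LieRules.

(** * Normal form of a metric bracket that reduces to the given one at t = 0 *)

Section NormalForm.
Variable K : numFieldType.
Local Notation A := (fps K).
Local Notation V := 'rV[A]_(2 + 4).
Local Notation e := (delta_mx 0 : 'I_(2 + 4) -> V).
Local Notation eK := (delta_mx 0 : 'I_(2 + 4) -> 'rV[K]_(2 + 4)).
Local Notation const := (map_mx (@fps_const K)).
Implicit Types x y z h : V.
Variables (br : V -> V -> V) (B : V -> V -> A).
Hypotheses (brL : lie_superalgebra br) (brB : metric_form br B).
Hypothesis br_const : forall x y, const (br x y) = g24_def 1 0 (const x) (const y).

Let brE : even_bilin br. Proof. by case: brL. Qed.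
Let brS : super_skew br. Proof. by case: brL. Qed.
Let brJ : super_jacobi br. Proof. by case: brL. Qed.
Let BI x y z : B (br x y) z = B x (br y z). Proof. by case: brB. Qed.

Let ev1 : homog false (e o1). Proof. exact: (@homog_delta A 2 4 o1). Qed.
Let ev2 : homog false (e o2). Proof. exact: (@homog_delta A 2 4 o2). Qed.

Lemma form_linear x a y z : B x (a *: y + z) = a * B x y + B x z.
Proof. by case: brB => -[BL _] *; apply: BL. Qed.

Lemma form_linearl x a y z : B (a *: y + z) x = a * B y x + B z x.
Proof. by case: brB => -[_ BL] *; apply: BL. Qed.

Lemma formD x y z : B x (y + z) = B x y + B x z.
Proof. by have := form_linear x 1 y z; rewrite scale1r mul1r. Qed.

Lemma form0 x : B x 0 = 0.
Proof. by apply: (addIr (B x 0)); rewrite -formD !add0r. Qed.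

Lemma formZ x a y : B x (a *: y) = a * B x y.
Proof. by have := form_linear x a y 0; rewrite form0 !addr0. Qed.

Lemma form0l x : B 0 x = 0.
Proof.
have := form_linearl x 1 0 0; rewrite scale1r mul1r addr0 => h.
by apply: (addIr (B 0 x)); rewrite add0r -h.
Qed.

Lemma formZl x a y : B (a *: y) x = a * B y x.
Proof. by have := form_linearl x a y 0; rewrite form0l !addr0. Qed.

Lemma formDl x y z : B (x + y) z = B x z + B y z.
Proof. by have := form_linearl z 1 x y; rewrite scale1r mul1r. Qed.

Lemma formNl x y : B (- x) y = - B x y.
Proof. by rewrite -scaleN1r formZl mulN1r. Qed.

Lemma form_evenC x y : homog false x -> homog false y -> B y x = B x y.
Proof. by case: brB => _ _ BS _ _ hx hy; rewrite (BS _ _ _ _ hx hy) mul1r. Qed.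

Lemma form_odd_self x : homog true x -> B x x = 0.
Proof.
case: brB => _ _ BS _ _ hx; have BN := BS _ _ _ _ hx hx.
have /(congr1 (fun M : 'M[A]_1 => M 0 0)) : (B x x)%:M = 0 :> 'M[A]_1.
  apply: fps_eq_opp_eq0; rewrite {1}BN /= -[in RHS]scaleN1r scale_scalar_mx.
  by rewrite expr1.
by rewrite !mxE.
Qed.

(** An even form pairs x with odd vectors to 0, so B(x, _) vanishes altogether, and the zero
    functional is represented only by 0. *)
Lemma form_nondeg_even x : homog false x -> B x (e o1) = 0 -> B x (e o2) = 0 -> x = 0.
Proof.
move=> hx x1 x2.
have Bx y : B x y = 0.
  have Bo i : parity i -> B x (e i) = 0.
    by case: brB => _ B0 _ _ _ pi; apply: (B0 _ _ _ _ hx (@homog_delta A 2 4 i)); rewrite pi.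
  rewrite (row_sum_delta y) (big_morph (B x) (formD x) (form0 x)) big1 // => i _.
  rewrite formZ; move: i; apply: ord6_ind; [by rewrite x1 mulr0|by rewrite x2 mulr0|..];
  by rewrite Bo ?mulr0.
case: brB => _ _ _ _ /(_ (\0 : {scalar V}))[x0 [_ uniq]].
by transitivity x0; [symmetry|]; apply: uniq => y; rewrite ?Bx ?form0l.
Qed.

(** Only [e1, e2] is in question. Invariance rewrites its pairings with e1 and e2 through [e1, e1]
    and [e2, e2], which are 0, so [e1, e2] is orthogonal to the even part. *)
Lemma even_abelian x y : homog false x -> homog false y -> br x y = 0.
Proof.
have brxx u : homog false u -> br u u = 0.
  by move=> hu; apply: fps_eq_opp_eq0; rewrite {1}(br_evenC brS hu hu).
have br12 : br (e o1) (e o2) = 0.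
  apply: form_nondeg_even; first exact: (homog_br brE ev1 ev2).
    by rewrite (br_evenC brS ev2 ev1) formNl BI brxx // form0 oppr0.
  by rewrite BI brxx // form0.
move=> hx hy; rewrite (homog_evenE hx) (homog_evenE hy).
move: (br_evenC brS ev1 ev2) (brxx _ ev1) (brxx _ ev2) br12.
move: (e o1) (e o2) (x 0 o1) (x 0 o2) (y 0 o1) (y 0 o2) => u v a b c d.
rewrite !(brDl brE, brDr brE, brZl brE, brZr brE) => -> -> -> ->.
by rewrite oppr0 !scaler0 !addr0 !scaler0 addr0.
Qed.

(* ad h is skew for the bracket of odd elements, because [h, [x, y]] = 0. *)
Lemma br_odd_skew h x y : homog false h -> homog true x -> homog true y ->
  br (br h x) y = - br x (br h y).
Proof.
move=> hh hx hy; apply/eqP; rewrite -addr_eq0 -(br_even_der brJ _ hh hx).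
by rewrite even_abelian //; apply: (homog_br brE hx hy).
Qed.

(** The Jacobi identity for x, x, x says that 3 [x, [x, x]] = 0. *)
Lemma br_odd_cube x : homog true x -> br x (br x x) = 0.
Proof.
move=> hx; apply: (@fps_muln_eq0 _ _ _ 2).
have hxx := homog_br brE hx hx; have := br_odd_jacobi brJ x hx hx.
rewrite [br (br x x) x](_ : _ = - br x (br x x)); last first.
  by rewrite (br_evenC brS hxx hx) opprK.
move=> /eqP; rewrite -subr_eq0 => /eqP h.
by rewrite mulrS mulr2n -[RHS]h opprD !opprK.
Qed.


Lemma br_even_odd h x : homog false h -> homog true (br h x).
Proof.
move=> hh; rewrite (row_sum_delta x) br_sumr //; apply: homog_sum => i _.
rewrite brZr //; apply: homogZ; have hi := @homog_delta A 2 4 i.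
case pi: (parity i) hi => hi; first exact: (homog_br brE hh hi).
by rewrite even_abelian //; apply: homog0.
Qed.

(** ad h kills the even part and so has odd values; thus l x is odd and l is a unit. *)
Lemma eigenvector_odd h x l : homog false h -> br h x = l *: x ->
  fps_const l != 0 -> homog true x.
Proof.
move=> hh hx l0; have [x1 x2] : (l *: x) 0 o1 = 0 /\ (l *: x) 0 o2 = 0.
  by rewrite -hx; apply/homog_odd/br_even_odd.
rewrite !mxE in x1 x2.
by apply: homog_oddP; apply: (fps_unit_eq0 l0); rewrite mulrC.
Qed.

Lemma const_coord1 x : const x = eK o1 -> fps_const (x 0 o1) = 1.
Proof. by move=> /rowP/(_ o1); rewrite !mxE. Qed.

(** The e1-coordinate of z is congruent to 1 modulo t, hence a unit, so z can replace e1 in the even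
    basis. *)
Lemma even_decomposition z x : homog false z -> const z = eK o1 ->
  homog false x -> exists a b, x = a *: z + b *: e o2.
Proof.
move=> hz /const_coord1 z1 hx.
have [|g zg _] := @fps_inverse K (z 0 o1); first by rewrite z1 oner_eq0.
exists (x 0 o1 * g), (x 0 o2 - x 0 o1 * g * z 0 o2).
rewrite {1}(homog_evenE hx) [X in _ = _ *: X + _](homog_evenE hz).
move: (e o1) (e o2) => u v; rewrite scalerDr !scalerA -[_ * g * z 0 o1]mulrA [g * z 0 o1]mulrC zg mulr1.
by rewrite -addrA -scalerDl addrCA subrr addr0.
Qed.

Lemma form_nondeg_basis z x : homog false z -> const z = eK o1 ->
  homog false x -> B x z = 0 -> B x (e o2) = 0 -> x = 0.
Proof.
move=> hz /const_coord1 z1 hx xz x2; apply: form_nondeg_even => //.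
apply: (@fps_unit_eq0 K (z 0 o1)); first by rewrite z1 oner_eq0.
by rewrite mulrC -formZ -[RHS]xz {2}(homog_evenE hz) formD [X in _ + X]formZ x2 mulr0 addr0.
Qed.

Lemma g24_K25 : g24_def 1 0 (eK o2) (eK o5) = eK o3.
Proof. by apply: row6P; rewrite g24_defE !mxE /=; ring. Qed.

Lemma g24_K23 : g24_def 1 0 (eK o2) (eK o3) = 0.
Proof. by apply: row6P; rewrite g24_defE !mxE /=; ring. Qed.

Lemma g24_K55 : g24_def 1 0 (eK o5) (eK o5) = eK o1.
Proof. by apply: row6P; rewrite g24_defE !mxE /=; ring. Qed.

Lemma g24_K46 : g24_def 1 0 (eK o4) (eK o6) = eK o1.
Proof. by apply: row6P; rewrite g24_defE !mxE /=; ring. Qed.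

(** The k-th coordinate of x is a unit; this is how coefficients are shown to vanish in the normal
    form. *)
Lemma scale_basis_eq0 k x a : const x = eK k -> a *: x = 0 -> a = 0.
Proof.
move=> /rowP/(_ k); rewrite !mxE !eqxx /= => xk /rowP/(_ k); rewrite !mxE.
by apply: fps_unit_eq0; rewrite xk oner_eq0.
Qed.

Definition mx6 (F1 F2 F3 F4 F5 F6 : V) : 'M[A]_(2 + 4) :=
  \matrix_(i < 2 + 4) match (i : nat).+1 with
  | 1 => F1 | 2 => F2 | 3 => F3 | 4 => F4 | 5 => F5 | _ => F6 end.

Lemma const_mx6 F1 F2 F3 F4 F5 F6 :
  const F1 = eK o1 -> const F2 = eK o2 -> const F3 = eK o3 -> const F4 = eK o4 ->
  const F5 = eK o5 -> const F6 = eK o6 -> const (mx6 F1 F2 F3 F4 F5 F6) = 1%:M.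
Proof.
move=> c1 c2 c3 c4 c5 c6; apply/row_matrixP => i; rewrite row1 -map_row rowK.
by move: i; apply: ord6_ind.
Qed.

Lemma homog_mx6 F1 F2 F3 F4 F5 F6 : homog false F1 -> homog false F2 ->
  homog true F3 -> homog true F4 -> homog true F5 -> homog true F6 ->
  forall i, homog (parity i) (row i (mx6 F1 F2 F3 F4 F5 F6)).
Proof. by move=> h1 h2 h3 h4 h5 h6; apply: ord6_ind; rewrite rowK. Qed.

Lemma mul_mx6 F1 F2 F3 F4 F5 F6 x : x *m mx6 F1 F2 F3 F4 F5 F6 =
  x 0 o1 *: F1 + (x 0 o2 *: F2 + (x 0 o3 *: F3 + (x 0 o4 *: F4 +
    (x 0 o5 *: F5 + x 0 o6 *: F6)))).
Proof. by rewrite mulmx_sum_row sum6 !rowK. Qed.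

(** Completed by e1 and e2, the four vectors form a matrix congruent to the identity modulo t, hence
    an invertible one, and it preserves parity. *)
Lemma odd_decomposition F3 F4 F5 F6 x :
  homog true F3 -> homog true F4 -> homog true F5 -> homog true F6 ->
  const F3 = eK o3 -> const F4 = eK o4 -> const F5 = eK o5 -> const F6 = eK o6 ->
  homog true x -> exists a b c d, x = a *: F3 + b *: F5 + c *: F4 + d *: F6.
Proof.
move=> h3 h4 h5 h6 c3 c4 c5 c6 hx.
have ce i : const (e i) = eK i by rewrite map_delta_mx.
have hM := homog_mx6 ev1 ev2 h3 h4 h5 h6.
have [N MN NM] := mx_const1_invertible (const_mx6 (ce o1) (ce o2) c3 c4 c5 c6).
move: (mx6 _ _ _ _ _ _) hM MN NM (mul_mx6 (e o1) (e o2) F3 F4 F5 F6) => M hM MN NM mulM.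
have xM : x *m N *m M = x by rewrite -mulmxA NM mulmx1.
have [] : (x *m N) 0 o1 = 0 /\ (x *m N) 0 o2 = 0.
  by apply: homog_odd; apply: (homog_mulmx_inv hM MN); rewrite xM.
move: (x *m N) xM (e o1) (e o2) mulM => y yM u v mulM y1 y2.
exists (y 0 o3), (y 0 o5), (y 0 o4), (y 0 o6).
rewrite -yM mulM y1 y2 !scale0r !add0r -!addrA; congr (_ + _).
by rewrite addrCA.
Qed.

(* The vectors E4, E6 span a hyperbolic plane and l^2 - (ad h)^2 maps the odd
   part into its orthogonal complement. *)
Lemma g24_normal_basis h E4 E6 w l l6 :
  homog false h -> homog true E4 -> homog true E6 -> homog true w ->
  const h = eK o2 -> const E4 = eK o4 -> const E6 = eK o6 -> const w = eK o5 ->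
  br h E4 = l *: E4 -> br h E6 = l6 *: E6 -> fps_const l = 1 -> fps_const l6 = -1 ->
  (forall z x, homog false z -> const z = eK o1 -> homog false x ->
    exists a b, x = a *: z + b *: h) ->
  (forall z x, homog false z -> const z = eK o1 -> homog false x ->
    B x z = 0 -> B x h = 0 -> x = 0) ->
  exists q F1 F2 F3 F5 F6,
    [/\ fps_const q = 0,
      [/\ homog false F1, homog false F2, homog true F3, homog true F5 & homog true F6],
      [/\ const F1 = eK o1, const F2 = eK o2, const F3 = eK o3, const F5 = eK o5
        & const F6 = eK o6],
      [/\ br F1 F3 = 0, br F1 E4 = 0, br F1 F5 = 0 & br F1 F6 = 0] &
      [/\ br F2 F3 = q *: F5, br F2 E4 = E4, br F2 F5 = F3 & br F2 F6 = - F6] /\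
      [/\ br F3 F3 = - (q *: F1), br F3 E4 = 0, br F3 F5 = 0 & br F3 F6 = 0] /\
      [/\ br E4 E4 = 0, br E4 F5 = 0 & br E4 F6 = F1] /\
      [/\ br F5 F5 = F1, br F5 F6 = 0 & br F6 F6 = 0]].
Proof.
move=> hh h4 h6 hw ch c4 c6 cw hE4 hE6 cl cl6 dec nondeg.
have l0 : fps_const l != 0 by rewrite cl oner_eq0.
have l60 : fps_const l6 != 0 by rewrite cl6 oppr_eq0 oner_eq0.
have self0 x a : homog true x -> br h x = a *: x -> fps_const a != 0 -> br x x = 0.
  move=> hx hxa a0; have := br_odd_skew hh hx hx.
  by rewrite hxa (brZl brE) (brZr brE) => /fps_eq_opp_eq0/(fps_unit_scale_eq0 a0).
have E44 := self0 _ _ h4 hE4 l0; have E66 := self0 _ _ h6 hE6 l60.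
have [Z ZE] : exists z, z = br E4 E6 by eexists.
have hZ : homog false Z by rewrite ZE; exact: (homog_br brE h4 h6).
have cZ : const Z = eK o1 by rewrite ZE br_const c4 c6 g24_K46.
(* Skewness of ad h on the pair E4, E6 gives (l + l6) Z = 0. *)
have l6E : l6 = - l.
  have := br_odd_skew hh h4 h6; rewrite hE4 hE6 (brZl brE) (brZr brE) -ZE.
  move/eqP; rewrite -addr_eq0 -scalerDl => /eqP/(scale_basis_eq0 cZ)/eqP.
  by rewrite addr_eq0 => /eqP ->; rewrite opprK.
(* As [E4, E4] = 0, the Jacobi identity gives [E4, Z] = -[E4, Z]. *)
have E4Z : br E4 Z = 0.
  apply: fps_eq_opp_eq0; rewrite {1}ZE (br_odd_jacobi brJ _ h4 h4) E44 (br0l brE) -ZE.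
  by rewrite add0r.
have E6Z : br E6 Z = 0.
  apply: fps_eq_opp_eq0; rewrite {1}ZE -(br_oddC brS h4 h6) (br_odd_jacobi brJ _ h6 h6).
  by rewrite E66 (br0l brE) (br_oddC brS h4 h6) -ZE add0r.
have hD y : homog true (br h y) by apply: br_even_odd.
have [F5 F5E] : exists x, x = (l * l) *: w - br h (br h w) by eexists.
have hF5 : homog true F5.
  by rewrite F5E; apply: homogD; [apply: homogZ | apply/homogN/hD].
have cF5 : const F5 = eK o5.
  rewrite F5E map_mxB map_mxZ rmorphM /= cl !br_const ch cw g24_K25 g24_K23.
  by rewrite mulr1 scale1r subr0.
(* Moving ad h twice across the bracket gives [x, (ad h)^2 w] = a^2 [x, w], which cancels l^2
   [x, w]. *)
have orthF5 x a : homog true x -> br h x = a *: x -> a * a = l * l -> br x F5 = 0.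
  move=> hx hxa aa; have xh y : homog true y -> br x (br h y) = (- a) *: br x y.
    by move=> hy; rewrite -[LHS]opprK -(br_odd_skew hh hx hy) hxa (brZl brE) scaleNr.
  rewrite F5E (brDr brE) (brZr brE) (brNr brE) !xh // scalerA mulrNN aa.
  by rewrite subrr.
have E4F5 := orthF5 _ _ h4 hE4 erefl.
have E6F5 : br E6 F5 = 0 by apply: (orthF5 _ _ h6 hE6); rewrite l6E mulrNN.
have [li lli cli] := fps_inverse l0; rewrite cl invr1 in cli.
have [F2 F2E] : exists x, x = li *: h by eexists.
have hF2 : homog false F2 by rewrite F2E; exact: homogZ.
have cF2 : const F2 = eK o2 by rewrite F2E map_mxZ /= cli scale1r ch.
have hE : h = l *: F2 by rewrite F2E scalerA lli scale1r.
have [F3 F3E] : exists x, x = br F2 F5 by eexists.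
have hF3 : homog true F3 by rewrite F3E; apply: br_even_odd.
have cF3 : const F3 = eK o3 by rewrite F3E br_const cF2 cF5 g24_K25.
have F5Z : br F5 Z = 0.
  rewrite ZE (br_odd_jacobi brJ _ hF5 h4) (br_oddC brS h4 hF5) E4F5.
  by rewrite (br_oddC brS h6 hF5) E6F5 (br0l brE) (br0r brE) subrr.
have [F1 F1E] : exists x, x = br F5 F5 by eexists.
have hF1 : homog false F1 by rewrite F1E; exact: (homog_br brE hF5 hF5).
have cF1 : const F1 = eK o1 by rewrite F1E br_const cF5 g24_K55.
have F5F1 : br F5 F1 = 0 by rewrite F1E br_odd_cube.
(* Write F1 = a Z + b h. Bracketing with F5 kills F1 and Z and leaves b l F3 = 0 up to sign, so b =
   0. *)
have [a F1Z] : exists a, F1 = a *: Z.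
  have [a [b F1ab]] := dec _ _ hZ cZ hF1; exists a.
  have := F5F1; rewrite F1ab (brDr brE) !(brZr brE) F5Z scaler0 add0r.
  rewrite (br_evenC brS hh hF5) hE (brZl brE) -F3E -scalerN scalerA => /eqP.
  rewrite scalerN oppr_eq0 => /eqP/(scale_basis_eq0 cF3) /(fps_unit_eq0 l0) b0.
  by rewrite b0 scale0r addr0.
have ca : fps_const a = 1.
  have := congr1 (fun x : 'rV[K]_(2 + 4) => x 0 o1) cF1.
  by rewrite F1Z map_mxZ cZ !mxE /= mulr1.
(* The rescaling that makes [E4, F6] equal to F1. *)
have [F6 F6E] : exists x, x = a *: E6 by eexists.
have hF6 : homog true F6 by rewrite F6E; exact: homogZ.
have cF6 : const F6 = eK o6 by rewrite F6E map_mxZ /= ca scale1r c6.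
have F2E4 : br F2 E4 = E4 by rewrite F2E (brZl brE) hE4 scalerA mulrC lli scale1r.
have F2F6 : br F2 F6 = - F6.
  rewrite F2E F6E (brZl brE) (brZr brE) hE6 l6E !scalerA -scaleNr.
  congr (_ *: _); transitivity (- a * (l * li)); first by ring.
  by rewrite lli mulr1.
have E4F6 : br E4 F6 = F1 by rewrite F6E (brZr brE) -ZE F1Z.
have F6F6 : br F6 F6 = 0 by rewrite F6E (brZr brE) (brZl brE) E66 !scaler0.
have F6F5 : br F6 F5 = 0 by rewrite F6E (brZl brE) E6F5 scaler0.
have central x : homog true x -> br x F1 = 0 -> br F1 x = 0.
  by move=> hx xF1; rewrite -[LHS]opprK -(br_evenC brS hF1 hx) xF1 oppr0.
have F1F5 := central _ hF5 F5F1.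
have F1E4 : br F1 E4 = 0 by apply: central => //; rewrite F1Z (brZr brE) E4Z scaler0.
have F1F6 : br F1 F6 = 0.
  apply: central => //; rewrite F1Z F6E (brZr brE) (brZl brE) E6Z.
  by rewrite !scaler0.
have F1F3 : br F1 F3 = 0.
  rewrite F3E (br_even_der brJ _ hF1 hF2) (even_abelian hF1 hF2) (br0l brE) F1F5.
  by rewrite (br0r brE) addr0.
have sk := br_odd_skew hF2.
have E4F3 : br E4 F3 = 0.
  by rewrite -[LHS]opprK F3E -(sk _ _ h4 hF5) F2E4 E4F5 oppr0.
have F6F3 : br F6 F3 = 0.
  by rewrite -[LHS]opprK F3E -(sk _ _ hF6 hF5) F2F6 (brNl brE) F6F5 !oppr0.
(* Skewness of ad F2 on the pair F5, F5 gives [F3, F5] = -[F5, F3], whereas the bracket of odd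
   vectors is symmetric. *)
have F3F5 : br F3 F5 = 0.
  by apply: fps_eq_opp_eq0; rewrite {1}F3E (sk _ _ hF5 hF5) -F3E (br_oddC brS hF3 hF5).
have [G GE] : exists x, x = br F2 F3 by eexists.
have hG : homog true G by rewrite GE; apply: br_even_odd.
have E4G : br E4 G = 0.
  by rewrite -[LHS]opprK GE -(sk _ _ h4 hF3) F2E4 E4F3 oppr0.
have F6G : br F6 G = 0.
  by rewrite -[LHS]opprK GE -(sk _ _ hF6 hF3) F2F6 (brNl brE) F6F3 !oppr0.
have [p [q [r [s Gpqrs]]]] : exists p q r s, G = p *: F3 + q *: F5 + r *: E4 + s *: F6.
  exact: odd_decomposition.
have F6E4 : br F6 E4 = F1 by rewrite (br_oddC brS h4 hF6).
(* Bracketing G with E4 isolates s F1, and bracketing it with F6 isolates r F1; both brackets are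
   0. *)
have s0 : s = 0.
  have := E4G; rewrite Gpqrs !(brDr brE) !(brZr brE) E4F3 E4F5 E44 E4F6.
  by rewrite !scaler0 !add0r => /(scale_basis_eq0 cF1).
have r0 : r = 0.
  have := F6G; rewrite Gpqrs !(brDr brE) !(brZr brE) F6F3 F6F5 F6F6 F6E4.
  by rewrite !scaler0 !add0r addr0 => /(scale_basis_eq0 cF1).
have {Gpqrs r0 s0} Gpq : G = p *: F3 + q *: F5 by rewrite Gpqrs r0 s0 !scale0r !addr0.
(* By invariance 0 = B(F2, [F3, F5]) = B(G, F5) = p B(F3, F5) = p B(F2, F1), because B(F5, F5) = 0.
   As F1 is also orthogonal to Z, p F1 is orthogonal to the whole even part. *)
have p0 : p = 0.
  have := BI F2 F3 F5; rewrite -GE F3F5 form0 Gpq formDl !formZl (form_odd_self hF5).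
  rewrite mulr0 addr0 {1}F3E BI -F1E => pB.
  apply: (scale_basis_eq0 cF1); apply: (nondeg Z) => //; first exact: homogZ.
    by rewrite F1Z !formZl {1}ZE BI E6Z form0 !mulr0.
  rewrite hE formZ formZl (form_evenC hF2 hF1) pB.
  by rewrite mulr0.
have {p0}Gq : br F2 F3 = q *: F5 by rewrite -GE Gpq p0 scale0r add0r.
exists q, F1, F2, F3, F5, F6; do 2?split => //.
(* At t = 0, ad e2 kills e3, so q has no constant term. *)
- have := congr1 (fun x => const x 0 o5) Gq; rewrite br_const cF2 cF3 g24_K23.
  by rewrite map_mxZ cF5 !mxE /= mulr1.
- split; last by split; split=> //; rewrite (br_oddC brS hF6 hF5).
  split=> //.
  + by rewrite {1}F3E (sk _ _ hF5 hF3) Gq (brZr brE) F1E.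
  + by rewrite (br_oddC brS h4 hF3).
  + by rewrite (br_oddC brS hF6 hF3).
Qed.

Lemma g24_normal_form : exists q (M : 'M[A]_(2 + 4)),
  [/\ fps_const q = 0, const M = 1%:M, forall i, homog (parity i) (row i M) &
      forall x y, br (x *m M) (y *m M) = g24_def 1 q x y *m M].
Proof.
have cad : map_mx (@fps_const K) (admx br (e o2)) =
    map_mx (@fps_const K) (admx (g24_def 1 0) (e o2)).
  apply/row_matrixP => i; rewrite -!map_row !rowK br_const.
  by rewrite map_g24_def rmorph1 rmorph0.
have [E4 [l [+ c4 cl]]] := eigen4 cad; rewrite mul_admx // => hE4.
have [E6 [l6 [+ c6 cl6]]] := eigen6 cad; rewrite mul_admx // => hE6.
have ce i : const (e i) = eK i by rewrite map_delta_mx.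
rewrite ce in c4; rewrite ce in c6.
have h4 : homog true E4 by apply: (eigenvector_odd ev2 hE4); rewrite cl oner_eq0.
have h6 : homog true E6.
  by apply: (eigenvector_odd ev2 hE6); rewrite cl6 oppr_eq0 oner_eq0.
(* The normal basis is built from h = e2 and w = e5. *)
have [q [F1 [F2 [F3 [F5 [F6 [q0 hF cF br1 [br2 [br3 [br4 br5]]]]]]]]]] :=
  g24_normal_basis ev2 h4 h6 (@homog_delta A 2 4 o5) (ce o2) c4 c6 (ce o5) hE4 hE6 cl cl6
    even_decomposition form_nondeg_basis.
case: hF => h1 h2 h3 h5 hF6; case: cF => c1 c2 c3 c5 cF6.
exists q, (mx6 F1 F2 F3 E4 F5 F6); split=> //; [exact: const_mx6|exact: homog_mx6|].
apply: bracket_of_rows => //; first exact: homog_mx6.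
have eM k : delta_mx 0 k *m mx6 F1 F2 F3 E4 F5 F6 = row k (mx6 F1 F2 F3 E4 F5 F6).
  by rewrite -rowE.
have evab := even_abelian.
case: br1 => b13 b14 b15 b16; case: br2 => b23 b24 b25 b26.
case: br3 => b33 b34 b35 b36; case: br4 => b44 b45 b46; case: br5 => b55 b56 b66.
apply: ord6_ind; apply: ord6_ind => // _; rewrite !rowK /coef_g24 /= 
  ?mul0mx -?scalemxAl ?eM ?rowK /= ?scale1r ?scaleN1r ?scaleNr //.
all: exact: even_abelian.
Qed.

End NormalForm.

(** * The algebras at numerical values of the parameter *)

Section Isomorphisms.
Variable C : numFieldType.
Local Notation V := 'rV[C]_(2 + 4).

Lemma g24_series_partial_sum (t : C) (x y : V) j n :
  \sum_(0 <= k < n.+2) t ^+ k * g24_series k x y 0 j = g24_def 1 t x y 0 j.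
Proof.
rewrite big_mkord 2!big_ord_recl big1 => [|i _]; last first.
  by rewrite /g24_series g24_defZ !scale0r addr0 mxE mulr0.
have -> : g24_def 1 t x y = g24_series 0 x y + t *: g24_series 1 x y.
  rewrite [LHS]g24_defZ scale1r; congr (_ + _ *: _).
by rewrite !mxE addr0 mul1r.
Qed.

(** Applied with a = b to the two coordinates of a vector in a block of (ad e2)^2: if one of them is
    non-zero, the eigenvalue equation holds. *)
Lemma mulf_eq0_or (x y a b : C) : (x != 0) || (y != 0) -> a * x = 0 -> b * y = 0 ->
  a = 0 \/ b = 0.
Proof.
move=> xy /eqP; rewrite mulf_eq0 => ax /eqP; rewrite mulf_eq0 => byy.
case/orP: ax => [/eqP|x0]; first by left.
case/orP: byy => [/eqP|y0]; first by right.
by move: xy; rewrite x0 y0.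
Qed.

(* (ad e2)^2 has the eigenvalues 1 and t on the odd part, so an isomorphism
   multiplies {1, s} by a scalar to get {1, t}. *)
Lemma g24_def_noniso (s t : C) : `|s| < 1 -> `|t| < 1 ->
  isomorphic (g24_def 1 s) (g24_def 1 t) -> s = t.
Proof.
move=> s1 t1 [f [[flin fhom] fbij fbr]]; pose e i : V := delta_mx 0 i.
have f0 : f 0 = 0.
  by apply: (addIr (f 0)); have := flin 1 0 0; rewrite !scale1r addr0 add0r => <-.
have fZ a x : f (a *: x) = a *: f x by have := flin a x 0; rewrite f0 !addr0.
have hf2 : homog false (f (e o2)) by apply/fhom/(@homog_delta _ 2 4 o2).
have hf i : parity i -> homog true (f (e i)).
  by move=> pi; apply: fhom; rewrite -pi; apply: (@homog_delta _ 2 4 i).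
(* The coordinates are grouped into the blocks (3, 5) and (4, 6), where (ad f(e2))^2 acts by u^2 t
   and u^2. *)
have nz i : parity i ->
    ((f (e i) 0 o3 != 0) || (f (e i) 0 o5 != 0)) || ((f (e i) 0 o4 != 0) || (f (e i) 0 o6 != 0)).
  move=> pi; apply/negPn/negP; rewrite !negb_or !negbK.
  move=> /andP[/andP[/eqP x3 /eqP x5] /andP[/eqP x4 /eqP x6]].
  have [x1 x2] := homog_odd (hf i pi).
  have /(bij_inj fbij)/rowP/(_ i) : f (e i) = f 0.
    by rewrite f0; apply: row6P; rewrite mxE.
  by rewrite !mxE !eqxx => /eqP; rewrite oner_eq0.
have E4 : g24_def 1 s (e o2) (e o4) = e o4 by apply: row6P; rewrite g24_defE !mxE /=; ring.
have E5 : g24_def 1 s (e o2) (e o5) = e o3 by apply: row6P; rewrite g24_defE !mxE /=; ring.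
have E3 : g24_def 1 s (e o2) (e o3) = s *: e o5 by apply: row6P; rewrite g24_defE !mxE /=; ring.
set u := f (e o2) 0 o2.
have [u3 u4 u5 u6] := homog_even hf2.
have ad x : [/\ g24_def 1 t (f (e o2)) x 0 o3 = u * x 0 o5,
    g24_def 1 t (f (e o2)) x 0 o5 = t * u * x 0 o3,
    g24_def 1 t (f (e o2)) x 0 o4 = u * x 0 o4 &
    g24_def 1 t (f (e o2)) x 0 o6 = - u * x 0 o6].
  by split; rewrite g24_defE ?u3 ?u4 ?u5 ?u6 /u; ring.
have u_or : 1 - u ^+ 2 * t = 0 \/ 1 - u ^+ 2 = 0.
  have := fbr (e o2) (e o4); rewrite E4; set v := f (e o4) => vE.
  have [v3 v5 v4 v6] := ad v; rewrite -vE in v3 v5 v4 v6.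
  have [v35|v46] := orP (nz o4 isT).
    left; have [] := @mulf_eq0_or (v 0 o3) (v 0 o5) (1 - u ^+ 2 * t) (1 - u ^+ 2 * t) v35 => //.
      by rewrite mulrBl mul1r {1}v3 v5; ring.
    by rewrite mulrBl mul1r {1}v5 v3; ring.
  right; have [] := @mulf_eq0_or (v 0 o4) (v 0 o6) (1 - u ^+ 2) (1 - u ^+ 2) v46 => //.
    by rewrite mulrBl mul1r {1}v4 {1}v4; ring.
  by rewrite mulrBl mul1r {1}v6 {1}v6; ring.
have s_or : s - u ^+ 2 * t = 0 \/ s - u ^+ 2 = 0.
  have := fbr (e o2) (e o5); rewrite E5; have := fbr (e o2) (e o3); rewrite E3 fZ.
  set w := f (e o5); set w' := f (e o3) => wE w'E.
  have [v3 v5 v4 v6] := ad w; rewrite -w'E in v3 v5 v4 v6.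
  have [z3 z5 z4 z6] := ad w'; rewrite -wE !mxE in z3 z5 z4 z6.
  have [v35|v46] := orP (nz o5 isT).
    left; have [] := @mulf_eq0_or (w 0 o3) (w 0 o5) (s - u ^+ 2 * t) (s - u ^+ 2 * t) v35 => //.
      by rewrite mulrBl z3 v5; ring.
    by rewrite mulrBl z5 v3; ring.
  right; have [] := @mulf_eq0_or (w 0 o4) (w 0 o6) (s - u ^+ 2) (s - u ^+ 2) v46 => //.
    by rewrite mulrBl z4 v4; ring.
  by rewrite mulrBl z6 v6; ring.
have nlt1 (z : C) : z = 1 -> ~~ (`|z| < 1) by move=> ->; rewrite normr1 ltxx.
have st1 : s * t <> 1.
  by move/nlt1; rewrite normrM mulr_ilt1.
have sn1 : s <> 1 by move/nlt1; rewrite s1.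
(* Both 1 and s lie in {u^2 t, u^2}. The four cases give s = 1, s t = 1, s = t and s = 1; only s = t
   is compatible with |s|, |t| < 1. *)
case: u_or => /eqP; rewrite subr_eq0 eq_sym => /eqP ut;
  case: s_or => /eqP; rewrite subr_eq0 => /eqP su.
- by case: sn1; rewrite su.
- by case: st1; rewrite su.
- by rewrite su ut mul1r.
- by case: sn1; rewrite su.
Qed.

Lemma g24_31 (l : C) (x y : V) : g24_3 l x y 0 o1 =
  x 0 o3 * y 0 o5 + x 0 o5 * y 0 o3 + l * (x 0 o4 * y 0 o6 + x 0 o6 * y 0 o4).
Proof. rewrite /g24_3; bracket_coords. Qed.

Lemma g24_32 (l : C) (x y : V) : g24_3 l x y 0 o2 = 0.
Proof. rewrite /g24_3; bracket_coords. Qed.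

Lemma g24_33 (l : C) (x y : V) : g24_3 l x y 0 o3 = x 0 o2 * y 0 o3 - x 0 o3 * y 0 o2.
Proof. rewrite /g24_3; bracket_coords. Qed.

Lemma g24_34 (l : C) (x y : V) : g24_3 l x y 0 o4 =
  l * (x 0 o2 * y 0 o4 - x 0 o4 * y 0 o2).
Proof. rewrite /g24_3; bracket_coords. Qed.

Lemma g24_35 (l : C) (x y : V) : g24_3 l x y 0 o5 = x 0 o5 * y 0 o2 - x 0 o2 * y 0 o5.
Proof. rewrite /g24_3; bracket_coords. Qed.

Lemma g24_36 (l : C) (x y : V) : g24_3 l x y 0 o6 =
  l * (x 0 o6 * y 0 o2 - x 0 o2 * y 0 o6).
Proof. rewrite /g24_3; bracket_coords. Qed.

(* e3 + l e5 and e3 - l e5 are eigenvectors of ad e2 for l and - l. *)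
Lemma g24_def_iso (l : C) : l != 0 -> isomorphic (g24_def 1 (l ^+ 2)) (g24_3 l).
Proof.
move=> l0.
(* Coordinates in the basis with e4, e3 + l e5, e6 and -(e3 - l e5) / (2 l) in positions 3 to 6; the
   last factor makes the bracket of the two eigenvectors equal to l e1. *)
pose f (y : V) : V := \row_j match (j : nat).+1 with
  | 1 => y 0 o1 | 2 => y 0 o2 | 3 => y 0 o4 | 4 => (y 0 o3 + y 0 o5 / l) / 2
  | 5 => y 0 o6 | _ => y 0 o5 - l * y 0 o3 end.
pose g (x : V) : V := \row_j match (j : nat).+1 with
  | 1 => x 0 o1 | 2 => x 0 o2 | 3 => x 0 o4 - x 0 o6 / (2 * l) | 4 => x 0 o3
  | 5 => l * x 0 o4 + x 0 o6 / 2 | _ => x 0 o5 end.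
exists f; split.
- split=> [a x y|[] x hx]; first by apply: row6P; rewrite !mxE /=; field.
    by have [x1 x2] := homog_odd hx; apply: homog_oddP; rewrite mxE.
  have [x3 x4 x5 x6] := homog_even hx; apply: homog_evenP; rewrite mxE //= ?x3 ?x5 //.
    by rewrite mul0r addr0 mul0r.
  by rewrite mulr0 subrr.
- by exists g => x; apply: row6P; rewrite !mxE /= ?mxE /=; field.
- move=> x y.
  have [f1 f2 f3] : [/\ forall z, f z 0 o1 = z 0 o1, forall z, f z 0 o2 = z 0 o2 &
    forall z, f z 0 o3 = z 0 o4] by split=> z; rewrite mxE.
  have [f4 f5 f6] : [/\ forall z, f z 0 o4 = (z 0 o3 + z 0 o5 / l) / 2,
    forall z, f z 0 o5 = z 0 o6 & forall z, f z 0 o6 = z 0 o5 - l * z 0 o3].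
    by split=> z; rewrite mxE.
  move: f f1 f2 f3 f4 f5 f6 => f f1 f2 f3 f4 f5 f6; apply: row6P.
  + by rewrite g24_31 f1 !f3 !f4 !f5 !f6 g24_def1; field.
  + by rewrite g24_32 f2 g24_def2.
  + by rewrite g24_33 !f2 !f3 g24_def4; ring.
  + by rewrite g24_34 !f2 !f4 g24_def3 g24_def5; field.
  + by rewrite g24_35 !f2 !f5 g24_def6; ring.
  + by rewrite g24_36 !f2 !f6 g24_def3 g24_def5; ring.
Qed.

End Isomorphisms.

(** * Convergence and smoothness *)

Section Smoothness.
Local Open Scope classical_set_scope.
Variable R : realType.
Local Notation C := R[i].

Lemma g24_series_sums r : sums_to (@g24_series C) r (g24_def 1).
Proof.
(* From two terms on, the partial sums are constant. *)
move=> t _ x y j; rewrite -(cvg_shiftn 2).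
rewrite (_ : (fun n => _) = fun=> (g24_def 1 t x y 0 j : C^o)); first exact: cvg_cst.
apply/funext => n; rewrite addn2; exact: (g24_series_partial_sum t x y j n).
Qed.

Lemma sqrtC_cvg0 : (sqrtC t : C^o) @[t --> (0 : C^o)^'] --> (0 : C^o).
Proof.
apply/cvgrPdist_lt => eps eps0.
have e20 : 0 < eps ^+ 2 by rewrite exprn_gt0.
near=> t; rewrite sub0r normrN -(@ltr_pXn2r _ 2) ?nnegrE ?normr_ge0 ?ltW //.
rewrite -normrX sqrtCK; near: t.
exact: dnbhs0_lt.
Unshelve. all: by end_near.
Qed.

Lemma g24_series_smooth : smooth_to_family (@g24_series C) (@g24_3 C) 0.
Proof.
split.
  exists 1, (g24_def 1); split; [exact: ltr01|exact: g24_series_sums|].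
  move=> s t /andP[_ s1] /andP[_ t1] /eqP st iso.
  by apply: st; exact: g24_def_noniso s1 t1 iso.
(* The eigenvalues of ad e2 other than 1 and -1 on the odd part are the square roots of t, whence
   the choice of lambda. *)
exists 1, (g24_def 1), sqrtC; split; [exact: ltr01|exact: g24_series_sums|..].
- move=> t /andP[t0 _]; rewrite -{1}[t]sqrtCK; apply: g24_def_iso.
  by rewrite sqrtC_eq0 -normr_gt0.
- exact: sqrtC_cvg0.
Qed.

End Smoothness.

(** * Every metric deformation is a reparametrised model *)

Section Uniqueness.
Variable K : numFieldType.

Lemma const_ext_bracket m n (phi : nat -> 'rV[K]_(m + n) -> _) x y :
  map_mx (@fps_const K) (ext_bracket phi x y) =
  phi 0%N (map_mx (@fps_const K) x) (map_mx (@fps_const K) y).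
Proof.
by apply/rowP => j; rewrite !mxE /fps_const !big_ord_recl !big_ord0 !addr0.
Qed.

(** The normal form is the model at q(t) with q(0) = 0, so q itself is the change of parameter. *)
Lemma g24_metric_deformation_unique (phi : nat -> 'rV[K]_(2 + 4) -> _) :
  metric_deformation (@g24_2 K) phi ->
  exists f : fps K, f 0%N = 0 /\ equivalent phi (reparam f (@g24_series K)).
Proof.
case=> -[phi0 _ _] [phiL [B phiB]].
have phi_const x y : map_mx (@fps_const K) (ext_bracket phi x y) =
    g24_def 1 0 (map_mx (@fps_const K) x) (map_mx (@fps_const K) y).
  by rewrite const_ext_bracket phi0 g24_2E.
have [q [M [q0 M1 Mh Mbr]]] := g24_normal_form phiL phiB phi_const.
exists q; split=> //; apply: (equivalent_mx M1 Mh) => x y.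
by rewrite reparam_g24_series // ext_g24_def Mbr.
Qed.

End Uniqueness.

Unset Implicit Arguments.
Set Strict Implicit.
Set Printing Implicit Defensive.

Theorem theorem3p4p2 (R : realType) :
  exists phi : nat -> 'rV[R[i]]_(2 + 4) -> 'rV[R[i]]_(2 + 4) -> 'rV[R[i]]_(2 + 4),
    [/\ metric_deformation (@g24_2 R[i]) phi,
        ~ trivial_deformation (@g24_2 R[i]) phi,
        forall phi' : nat -> 'rV[R[i]]_(2 + 4) -> 'rV[R[i]]_(2 + 4) -> 'rV[R[i]]_(2 + 4),
          metric_deformation (@g24_2 R[i]) phi' ->
          ~ trivial_deformation (@g24_2 R[i]) phi' ->
          exists f : fps R[i], f 0%N = 0 /\ equivalent phi' (reparam f phi)
      & smooth_to_family phi (@g24_3 R[i]) 0].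
Proof.
exists (@g24_series R[i]); split.
- exact: g24_series_metric.
- exact: g24_series_nontrivial.
- by move=> phi' phiM _; apply: g24_metric_deformation_unique.
- exact: g24_series_smooth.
Qed.
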